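(* For every $p\ge1$, there exists a polynomial-time $p$-pass streaming algorithm using $\widetilde{O}(n^{1+1/p})$ space that returns an ordering which is a $3$-approximation in expectation for \textsc{fas-t}, i.e., an ordering $\sigma$ with $\mathbb{E}|B_G(\sigma)|\le 3\beta_G$.
   Context: Input: a tournament $G=(V,E)$ on $n$ vertices presented as a stream of its edges in arbitrary order. For an ordering (bijection) $\sigma\colon V\to[n]$, $B_G(\sigma)=\{(v,u)\in E:\sigma(u)<\sigma(v)\}$ and $\beta_G=\min_\sigma|B_G(\sigma)|$. $\widetilde{O}(f)$ means $O(f\cdot\mathrm{polylog}\,n)$. *)

(* Defs.v *)
From mathcomp Require Import all_boot all_order all_algebra all_fingroup.
From mathcomp Require Import all_classical all_reals all_analysis.

Set Implicit Arguments.
Unset Strict Implicit.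
Unset Printing Implicit Defensive.

Import Order.TTheory GRing.Theory Num.Theory.

(** * Tournaments and feedback arc sets *)

Definition tournament (n : nat) (E : rel 'I_n) : Prop :=
  (forall u, ~~ E u u) /\ (forall u v, u != v -> E u v (+) E v u).

(* An ordering sigma : V -> [n] is a permutation of 'I_n, positions being
   counted from 0. *)
Definition back_edges (n : nat) (E : rel 'I_n) (sigma : 'S_n) :
    {set 'I_n * 'I_n} :=
  [set e | E e.1 e.2 & sigma e.2 < sigma e.1].

Definition beta (n : nat) (E : rel 'I_n) : nat :=
  #|back_edges E [arg min_(s < (1%g : 'S_n)) #|back_edges E s|]|.

Definition edge_stream (n : nat) (E : rel 'I_n) (es : seq ('I_n * 'I_n)) :
    Prop :=
  perm_eq es (enum [pred e : 'I_n * 'I_n | E e.1 e.2]).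

(** * Randomized multi-pass streaming algorithms

    An algorithm is a program of a random access machine: a while-program over
    one unbounded array of natural numbers. It does not depend on [n], which
    it finds in cell 0. The input is accessible only through a one-way head
    on the stream, and randomness only through fair coin flips that are not
    remembered unless they are stored. *)

Inductive binop := Add | Sub | Mul | Div | Mod | Lt | Eq.

Inductive expr :=
  | Const of nat
  | Cell of expr
  | Bin of binop & expr & expr.

Inductive cmd :=
  | Store of expr & expr          (* mem[e1] := e2 *)
  | Flip of expr                  (* mem[e] := a fair random bit *)
  | NewPass                       (* move the head to the first edge *)
  | Read of expr                  (* see [step] *)
  | Emit of expr                  (* append the value to the output *)
  | Seq of cmd & cmd
  | If of expr & cmd & cmd
  | While of expr & cmd.

Definition eval_binop (o : binop) (x y : nat) : nat :=
  match o with
  | Add => x + y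
  | Sub => x - y
  | Mul => x * y
  | Div => x %/ y
  | Mod => x %% y
  | Lt => x < y
  | Eq => x == y
  end.

Fixpoint eval (mem : seq nat) (e : expr) : nat :=
  match e with
  | Const k => k
  | Cell a => nth 0 mem (eval mem a)
  | Bin o e1 e2 => eval_binop o (eval mem e1) (eval mem e2)
  end.

Record state := State {
  mem : seq nat;
  rest : seq (nat * nat);         (* the part of the stream not yet read in
                                     the current pass *)
  passes : nat;                   (* the number of passes started *)
  coins : seq bool;
  output : seq nat                (* write-only *)
}.

Definition write (a x : nat) (s : state) : state :=
  State (set_nth 0 (mem s) a x) (rest s) (passes s) (coins s) (output s).

(* A configuration is a stack of commands left to execute, and a state. Since
   a program is fixed, the stack has bounded depth and each step performs
   boundedly many arithmetic operations on numbers whose length is linear in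
   the number of bits in memory. *)
Definition config := (seq cmd * state)%type.

Definition step (stream : seq (nat * nat)) (cf : config) : config :=
  let s := cf.2 in
  let ev := eval (mem s) in
  match cf.1 with
  | [::] => cf
  | Store a e :: k => (k, write (ev a) (ev e) s)
  | Flip a :: k =>
      (k, write (ev a) (head false (coins s))
            (State (mem s) (rest s) (passes s) (behead (coins s)) (output s)))
  | NewPass :: k =>
      (k, State (mem s) stream (passes s).+1 (coins s) (output s))
  | Read a :: k =>
      (* cell a tells whether an edge was read, cells a+1 and a+2 receive its
         tail and head *)
      match rest s with
      | [::] => (k, write (ev a) 0 s)
      | (u, v) :: r =>
          (k, write (ev a) 1 (write (ev a).+1 u (write (ev a).+2 v
                (State (mem s) r (passes s) (coins s) (output s)))))
      end
  | Emit e :: k =>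
      (k, State (mem s) (rest s) (passes s) (coins s) (rcons (output s) (ev e)))
  | Seq c1 c2 :: k => ([:: c1, c2 & k], s)
  | If e c1 c2 :: k => ((if ev e != 0 then c1 else c2) :: k, s)
  | While e c :: k => (if ev e != 0 then [:: c, While e c & k] else k, s)
  end.

(* [run A es r t] is the configuration of A on stream es and coin flips r
   after t steps. No pass is in progress initially. *)
Definition run (A : cmd) (n : nat) (es : seq ('I_n * 'I_n)) (r : seq bool)
    (t : nat) : config :=
  let stream := [seq (val e.1, val e.2) | e <- es] in
  iter t (step stream) ([:: A], State [:: n] [::] 0 r [::]).

(* Every cell up to the highest address ever written is counted. *)
Definition space_bits (s : state) : nat :=
  \sum_(x <- mem s) (trunc_log 2 x).+1.

(* On this input and these coins, A halts within T steps, makes at most p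
   passes, always uses at most S bits, and outputs the vertices in the order
   given by sigma, first vertex first. *)
Definition returns_within (A : cmd) (n : nat) (es : seq ('I_n * 'I_n))
    (r : seq bool) (T p S : nat) (sigma : 'S_n) : Prop :=
  [/\ (run A es r T).1 = [::],
      passes (run A es r T).2 <= p,
      forall t, space_bits (run A es r t).2 <= S
    & output (run A es r T).2 = [seq val ((sigma^-1)%g i) | i <- enum 'I_n]].

(** * Resource bounds and expectation *)

Definition poly_bounded (T : nat -> nat) : Prop :=
  exists c k : nat, forall n, T n <= c * n ^ k + c.

Local Open Scope ring_scope.

(* f = O (g * polylog n) *)
Definition soft_O (R : realType) (f g : nat -> R) : Prop :=
  exists (C : R) (k N : nat), forall n : nat, (N <= n)%N ->
    f n <= C * (g n * ln (n%:R : R) ^+ k).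

(* Expectation over m independent fair coin flips. *)
Definition expect_coins (R : realType) (m : nat) (X : m.-tuple bool -> R) : R :=
  (\sum_r X r) / 2 ^+ m.

(* Main.v *)
Require Import Defs.
From mathcomp Require Import all_boot all_order all_algebra all_fingroup.
From mathcomp Require Import all_classical all_reals all_analysis.
From mathcomp Require Import zify ring lra.

(* The algorithm is KwikSort with pivots sampled with replacement. A set of
   still unordered vertices is a cell; a pivot splits its cell into the
   vertices with an edge to the pivot, the pivot, and the others. The vertices
   carry the number of vertices in earlier cells. Pass i draws about m^i
   pivots (up to logarithms), where m is about n^(1/p), and stores the edges
   inside cells that touch a pivot.

   Approximation. Fix an optimal ordering. When each vertex of a cell serves
   once as pivot, a cyclic triangle inside the cell creates three back edges,
   and an optimal back edge inside the cell is separated twice by its ends and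
   once more by the apex of every cyclic triangle containing it. As each cyclic
   triangle contains an optimal back edge, (decided back edges) + 3 (undecided
   optimal back edges) is a supermartingale, and its first step gains
   6 beta / 2^b, which pays for failures.

   Space. The cell of a given vertex shrinks by a constant factor in
   expectation when its pivot is uniform, so after about m^i pivots no cell is
   much larger than n / m^i, except with probability polynomially small. Then
   pass i + 1 stores about n m edges. When the store overflows, the vertices
   are sorted by indegree, which is exact when beta = 0; otherwise beta >= 1
   and the cost of failure is below the gain of the first step. *)

Set Implicit Arguments.
Unset Strict Implicit.
Unset Printing Implicit Defensive.

Import Order.TTheory GRing.Theory Num.Theory.

(** * Programs with arrays *)

Local Open Scope nat_scope.

(* Array [r] occupies the addresses [8 * i + arr_code r]. A [Read] at an entry
   of [Fl] fills the entries of [Fl], [Tl] and [Hd] with the same index. [Sc]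
   holds scalars, [Cc] the keys of the cells, [Dd] counts of incoming edges,
   [Xx] the samples of the pass and [Mk] marks the vertices sampled so far. *)
Inductive arr := Sc | Cc | Dd | Xx | Mk | Fl | Tl | Hd.

Definition arr_code (r : arr) : nat :=
  match r with
  | Sc => 0 | Cc => 1 | Dd => 2 | Xx => 3 | Mk => 4 | Fl => 5 | Tl => 6 | Hd => 7
  end.

Inductive aexp := Cst of nat | At of arr & aexp | Op of binop & aexp & aexp.

Local Notation Var i := (At Sc (Cst i)).

Fixpoint compile (e : aexp) : expr :=
  match e with
  | Cst k => Const k
  | At r e => Cell (Bin Add (Bin Mul (Const 8) (compile e)) (Const (arr_code r)))
  | Op o e1 e2 => Bin o (compile e1) (compile e2)
  end.

Definition addr (r : arr) (e : aexp) : expr :=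
  Bin Add (Bin Mul (Const 8) (compile e)) (Const (arr_code r)).

Definition memory := arr -> nat -> nat.

Fixpoint aeval (g : memory) (e : aexp) : nat :=
  match e with
  | Cst k => k
  | At r e => g r (aeval g e)
  | Op o e1 e2 => eval_binop o (aeval g e1) (aeval g e2)
  end.

Definition upd (g : memory) (r : arr) (i x : nat) : memory :=
  fun r' i' => if (arr_code r' == arr_code r) && (i' == i) then x else g r' i'.
Arguments upd g r i x r' i' /.

Record astate := AState {
  amem : memory;
  arest : seq (nat * nat);
  apasses : nat;
  acoins : seq bool;
  aoutput : seq nat
}.

(** Cells never written read as 0, so every array starts zeroed, except entry 0 of [Sc]: it is
    machine cell 0 and holds [n]. *)
Definition abs (s : state) : astate :=
  AState (fun r i => nth 0 (Defs.mem s) (8 * i + arr_code r)) (rest s) (passes s)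
    (coins s) (output s).

Definition aset (a : astate) (r : arr) (i x : nat) : astate :=
  AState (upd (amem a) r i x) (arest a) (apasses a) (acoins a) (aoutput a).

Definition Set_ (r : arr) (i e : aexp) : cmd := Store (addr r i) (compile e).
Definition SetVar (v : nat) (e : aexp) : cmd := Set_ Sc (Cst v) e.
(** The guard is false, so the body never runs and no pass is counted. *)
Definition Skip : cmd := While (Const 0) NewPass.
Definition For (v : nat) (e : aexp) (c : cmd) : cmd :=
  Seq (SetVar v (Cst 0))
    (While (compile (Op Lt (Var v) e))
       (Seq c (SetVar v (Op Add (Var v) (Cst 1))))).

Lemma eval_compile (s : state) (e : aexp) :
  Defs.eval (Defs.mem s) (compile e) = aeval (amem (abs s)) e.
Proof. by elim: e => //= [r e -> //|o e1 -> e2 ->]. Qed.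

Lemma arr_code_lt (r : arr) : arr_code r < 8.
Proof. by case: r. Qed.

(** The arrays are interleaved modulo 8 with distinct codes, so no two entries share an address. *)
Lemma abs_write (s : state) (r : arr) (i x : nat) :
  abs (write (8 * i + arr_code r) x s) = aset (abs s) r i x.
Proof.
rewrite /abs /aset /=; congr AState; apply/funext => r'; apply/funext => i'.
rewrite nth_set_nth /=; have := arr_code_lt r; have := arr_code_lt r'.
case: ifP => [/eqP ? | /eqP ?] ? ?; first by rewrite (_ : _ && _) //; lia.
by rewrite (_ : _ && _ = false) //; lia.
Qed.

(* Valid when every loop makes at most [Z] iterations. *)
Fixpoint max_time (Z : nat) (c : cmd) : nat :=
  match c with
  | Seq c1 c2 => (max_time Z c1 + max_time Z c2).+1
  | If _ c1 c2 => (max_time Z c1 + max_time Z c2).+1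
  | While _ c1 => (Z * (max_time Z c1).+1).+1
  | _ => 1
  end.

(** * A program logic for total correctness with time and memory bounds *)

Section Logic.

Variables (W B : nat) (stream : seq (nat * nat)).

(** [W] bounds the indices in each of the eight arrays, [B] the stored values. *)
Definition fits (s : state) : Prop :=
  size (Defs.mem s) <= 8 * W.+1 /\ all (fun x => x <= B) (Defs.mem s).

Local Notation exec := (fun t cf => iter t (step stream) cf).

(** Total correctness from every concrete state with abstraction [a] and under every continuation
    [k]. The memory bound is demanded at all intermediate steps, because space is limited throughout
    the run. [B] also limits the iterations of each loop. *)
Definition wp (c : cmd) (Q : astate -> Prop) (a : astate) : Prop :=
  forall s k, abs s = a -> fits s ->
  exists t s', [/\ t <= max_time B c, exec t (c :: k, s) = (k, s'),
    Q (abs s') & forall j, j <= t -> fits (exec j (c :: k, s)).2].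

Lemma fits_write (s : state) (r : arr) (i x : nat) :
  i <= W -> x <= B -> fits s -> fits (write (8 * i + arr_code r) x s).
Proof.
move=> iW xB [sz al]; have := arr_code_lt r; split=> /=.
  by rewrite size_set_nth; lia.
apply/(all_nthP 0) => j _; rewrite nth_set_nth /=; case: ifP => // _.
have [lt|ge] := ltnP j (size (Defs.mem s)); first exact: (all_nthP 0 al).
by rewrite nth_default.
Qed.

Lemma wp_step (c : cmd) (Q : astate -> Prop) (a : astate) :
  0 < max_time B c ->
  (forall s k, abs s = a -> fits s ->
    exists s', [/\ step stream (c :: k, s) = (k, s'), Q (abs s') & fits s']) ->
  wp c Q a.
Proof.
move=> c0 H s k sa fs; have [s' [e q f]] := H s k sa fs.
by exists 1, s'; split=> // -[|[|//]] _ //; rewrite /= e.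
Qed.

Lemma wp_mono (c : cmd) (Q Q' : astate -> Prop) (a : astate) :
  wp c Q a -> (forall a', Q a' -> Q' a') -> wp c Q' a.
Proof.
move=> H QQ s k sa fs; have [t [s' [? ? q ?]]] := H s k sa fs.
by exists t, s'; split=> //; apply: QQ.
Qed.

Lemma wp_set (r : arr) (i e : aexp) (Q : astate -> Prop) (a : astate) :
  aeval (amem a) i <= W -> aeval (amem a) e <= B ->
  Q (aset a r (aeval (amem a) i) (aeval (amem a) e)) ->
  wp (Set_ r i e) Q a.
Proof.
move=> iW eB q; apply: wp_step => // s k sa fs.
rewrite /step /= !eval_compile sa.
exists (write (8 * aeval (amem a) i + arr_code r) (aeval (amem a) e) s).
by split=> //; [rewrite abs_write sa|apply: fits_write].
Qed.

Lemma wp_flip (r : arr) (i : aexp) (Q : astate -> Prop) (a : astate) :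
  aeval (amem a) i <= W -> 0 < B ->
  Q (AState (upd (amem a) r (aeval (amem a) i) (head false (acoins a)))
       (arest a) (apasses a) (behead (acoins a)) (aoutput a)) ->
  wp (Flip (addr r i)) Q a.
Proof.
move=> iW B0 q; apply: wp_step => // s k sa fs.
rewrite /step /= !eval_compile sa.
set s1 := State _ _ _ _ _.
exists (write (8 * aeval (amem a) i + arr_code r) (head false (coins s)) s1).
split=> //; last by apply: fits_write => //; apply: leq_trans B0; case: head.
by rewrite abs_write; move: q; rewrite -sa.
Qed.

Lemma wp_newpass (Q : astate -> Prop) (a : astate) :
  Q (AState (amem a) stream (apasses a).+1 (acoins a) (aoutput a)) ->
  wp NewPass Q a.
Proof.
move=> q; apply: wp_step => // s k sa fs; eexists; split; first reflexivity.
  by move: q; rewrite -sa.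
exact: fs.
Qed.

Lemma wp_emit (e : aexp) (Q : astate -> Prop) (a : astate) :
  Q (AState (amem a) (arest a) (apasses a) (acoins a)
       (rcons (aoutput a) (aeval (amem a) e))) ->
  wp (Emit (compile e)) Q a.
Proof.
move=> q; apply: wp_step => // s k sa fs; eexists; split; first reflexivity.
  by move: q; rewrite -sa /abs /= eval_compile.
exact: fs.
Qed.

Lemma wp_read (i : aexp) (Q : astate -> Prop) (a : astate) :
  aeval (amem a) i <= W -> 0 < B ->
  all (fun e => (e.1 <= B) && (e.2 <= B)) (arest a) ->
  Q (match arest a with
     | [::] => aset a Fl (aeval (amem a) i) 0
     | (u, v) :: l =>
         AState (upd (upd (upd (amem a) Hd (aeval (amem a) i) v)
                          Tl (aeval (amem a) i) u) Fl (aeval (amem a) i) 1)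
           l (apasses a) (acoins a) (aoutput a)
     end) ->
  wp (Read (addr Fl i)) Q a.
Proof.
move=> iW B0 al q; apply: wp_step => // s k sa fs.
rewrite /step /= !eval_compile sa.
have rs : rest s = arest a by rewrite -sa.
rewrite rs; case: (arest a) al q => [_|[u v] l /= /andP[/andP[uB vB] _]] q.
  exists (write (8 * aeval (amem a) i + arr_code Fl) 0 s).
  by split=> //; [rewrite abs_write sa|apply: fits_write].
set s1 := State _ _ _ _ _.
exists (write (8 * aeval (amem a) i + arr_code Fl) 1
          (write (8 * aeval (amem a) i + arr_code Tl) u
            (write (8 * aeval (amem a) i + arr_code Hd) v s1))).
split; first by rewrite -!addnS.
  by rewrite !abs_write; move: q; rewrite -sa.
by do 3 apply: fits_write => //.
Qed.

Lemma wp_seq (c1 c2 : cmd) (Q : astate -> Prop) (a : astate) :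
  wp c1 (wp c2 Q) a -> wp (Seq c1 c2) Q a.
Proof.
move=> H s k sa fs.
have [t1 [s1 [le1 e1 q1 f1]]] := H s (c2 :: k) sa fs.
have fs1 : fits s1 by have := f1 t1 (leqnn _); rewrite e1.
have [t2 [s2 [le2 e2 q2 f2]]] := q1 s1 k erefl fs1.
exists (t2 + t1).+1, s2; split => //.
- by rewrite /= ltnS addnC leq_add.
- by rewrite iterSr /= iterD e1.
- move=> [_|j]; first exact: fs.
  rewrite ltnS iterSr /= => jt.
  have [le|lt] := leqP j t1; first exact: f1.
  have -> : j = (j - t1) + t1 by lia.
  by rewrite iterD e1; apply: f2; lia.
Qed.

Lemma wp_if (e : aexp) (c1 c2 : cmd) (Q : astate -> Prop) (a : astate) :
  (aeval (amem a) e != 0 -> wp c1 Q a) ->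
  (aeval (amem a) e = 0 -> wp c2 Q a) ->
  wp (If (compile e) c1 c2) Q a.
Proof.
move=> H1 H2 s k sa fs.
have st : step stream (If (compile e) c1 c2 :: k, s) =
   ((if aeval (amem a) e != 0 then c1 else c2) :: k, s).
  by rewrite /step /= eval_compile sa.
have {H1 H2} : wp (if aeval (amem a) e != 0 then c1 else c2) Q a.
  by case: ifP => [|/eqP]; [exact: H1|exact: H2].
move=> /(_ s k sa fs)[t [s' [le e1 q f]]]; exists t.+1, s'; split=> //.
- by rewrite /= ltnS (leq_trans le) //; case: ifP; rewrite ?leq_addr ?leq_addl.
- by rewrite iterSr st.
- by move=> [_|j]; [exact: fs|rewrite ltnS iterSr st; exact: f].
Qed.

Lemma wp_skip (Q : astate -> Prop) (a : astate) : Q a -> wp Skip Q a.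
Proof.
by move=> q; apply: wp_step => // s k sa fs; exists s; split=> //; rewrite sa.
Qed.

Lemma wp_while (e : aexp) (c : cmd) (N : nat) (I : nat -> astate -> Prop)
    (Q : astate -> Prop) :
  (forall j a, j < N -> I j a -> aeval (amem a) e != 0 /\ wp c (I j.+1) a) ->
  (forall a, I N a -> aeval (amem a) e = 0 /\ Q a) ->
  forall j a, j <= N -> N <= j + B -> I j a -> wp (While (compile e) c) Q a.
Proof.
move=> body exit j a jN NB Ia.
(* The induction is on the number [d] of iterations left and needs a time bound in terms of [d];
   [N <= j + B] relates it to [max_time]. *)
suff H d : forall j a, j + d = N -> I j a -> forall s k, abs s = a -> fits s ->
  exists t s', [/\ t <= (d * (max_time B c).+1).+1,
    exec t (While (compile e) c :: k, s) = (k, s'),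
    Q (abs s') & forall j, j <= t -> fits (exec j (While (compile e) c :: k, s)).2].
  move=> s k sa fs.
  have [t [s' [le ? ? ?]]] := H (N - j) j a (subnKC jN) Ia s k sa fs.
  exists t, s'; split=> //; apply: leq_trans le _.
  by rewrite /= ltnS leq_mul2r; apply/orP; right; lia.
elim: d => [|d IH] {NB Ia jN}j {}a jd Ia s k sa fs.
  have eN : j = N by lia.
  have [e0 q] : aeval (amem a) e = 0 /\ Q a by apply: exit; rewrite -eN.
  exists 1, s; split => //; first by rewrite /= /step /= eval_compile sa e0.
    by rewrite sa.
  by move=> [|[|//]] _ //; rewrite /= /step /= eval_compile sa e0.
have [|e0 w] := body j a _ Ia; first by lia.
have [t1 [s1 [le1 e1 q1 f1]]] := w s (While (compile e) c :: k) sa fs.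
have fs1 : fits s1 by have := f1 t1 (leqnn _); rewrite e1.
have [|t2 [s2 [le2 e2 q2 f2]]] := IH j.+1 (abs s1) _ q1 s1 k erefl fs1.
  by rewrite addSnnS.
have st : step stream (While (compile e) c :: k, s) = ([:: c, While (compile e) c & k], s).
  by rewrite /step /= eval_compile sa e0.
exists (t2 + t1).+1, s2; split=> //.
- by lia.
- by rewrite iterSr st iterD e1.
- move=> [_|i]; first exact: fs.
  rewrite ltnS iterSr st => jt.
  have [le|lt] := leqP i t1; first exact: f1.
  have -> : i = (i - t1) + t1 by lia.
  by rewrite iterD e1; apply: f2; lia.
Qed.

(** The bound [e] is evaluated anew at each test, so the invariant must keep its value at [N]; the
    body must restore the loop variable. *)
Lemma wp_for (N : nat) (I : nat -> astate -> Prop) (v : nat) (e : aexp)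
    (c : cmd) (Q : astate -> Prop) (a : astate) :
  v <= W -> N <= B ->
  I 0 (aset a Sc v 0) ->
  (forall j a, j <= N -> amem a Sc v = j -> I j a -> aeval (amem a) e = N) ->
  (forall j a, j < N -> amem a Sc v = j -> I j a ->
    wp c (fun a' => amem a' Sc v = j /\ I j.+1 (aset a' Sc v j.+1)) a) ->
  (forall a, amem a Sc v = N -> I N a -> Q a) ->
  wp (For v e c) Q a.
Proof.
move=> vW NB I0 bound body exit; apply: wp_seq; apply: wp_set => //.
apply: (@wp_while _ _ N (fun j a => amem a Sc v = j /\ I j a) _ _ _ 0) => //.
- move=> j a' jN [va Ia] /=; split.
    by rewrite va (bound j) ?jN // ltnW.
  apply: wp_seq; apply: wp_mono (body j a' jN va Ia) _ => a1 [va1 Ia1].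
  apply: wp_set => //=; rewrite va1 addn1; first exact: leq_trans NB.
  by split=> //=; rewrite !eqxx.
- by move=> a' [va Ia] /=; rewrite va (bound N) // ltnn; split=> //; apply: exit.
- by split=> //=; rewrite eqxx.
Qed.

(** A halted configuration is a fixed point of [step], which extends the bounds from the running
    time to all times. *)
Lemma wp_run (c : cmd) (Q : astate -> Prop) (s : state) (T : nat) :
  wp c Q (abs s) -> fits s -> max_time B c <= T ->
  exists s', [/\ exec T ([:: c], s) = ([::], s'), Q (abs s')
    & forall t, fits (exec t ([:: c], s)).2].
Proof.
move=> H fs cT; have [t [s' [le e q f]]] := H s [::] erefl fs.
have halt d : exec (d + t) ([:: c], s) = ([::], s').
  by elim: d => [|d IH]; rewrite ?add0n // addSn /= IH.
exists s'; split=> //; first by rewrite -(subnK (leq_trans le cT)) halt.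
move=> j; have [jt|tj] := leqP j t; first exact: f.
by rewrite -(subnK (ltnW tj)) halt; have := f t (leqnn t); rewrite e.
Qed.

End Logic.

Lemma fits_space (W B : nat) (s : state) :
  fits W B s -> space_bits s <= 8 * W.+1 * (trunc_log 2 B).+1.
Proof.
move=> [sz al]; apply: leq_trans (_ : size (Defs.mem s) * (trunc_log 2 B).+1 <= _).
  rewrite /space_bits -sum1_size big_distrl /= big_seq [leqRHS]big_seq.
  apply: leq_sum => x xs; rewrite mul1n ltnS leq_trunc_log //.
  exact: (allP al).
by rewrite leq_mul2r sz orbT.
Qed.

(** * Pivots *)

Section Pivots.

Variables (n : nat) (E : rel 'I_n).
Hypothesis tE : tournament E.
Implicit Types (c : 'I_n -> nat) (u v w : 'I_n).

Definition cell c v : {set 'I_n} := [set u | c u == c v].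
Definition before c w : nat := #|[set u | (c u == c w) && E u w]|.
Definition after c w : nat := #|[set u | (c u == c w) && E w u]|.

(** If labels count the vertices in earlier cells, so do the new ones; hence no other cell has to be
    renumbered. *)
Definition pivot c w v : nat :=
  if c v != c w then c v
  else if v == w then c w + before c w
  else if E w v then c w + (before c w).+1 else c w.

(** Each cell owns an interval of labels as long as the cell is large, which leaves room for all
    later splits. *)
Definition spaced c : Prop :=
  (forall u v, c u < c v -> c u + #|cell c u| <= c v) /\
  (forall v, c v + #|cell c v| <= n).

Lemma edge_irr u : E u u = false.
Proof. by apply/negbTE; case: tE. Qed.

Lemma edge_asym u v : E u v -> E v u = false.
Proof.
case: tE => irr tot uv; have [e|ne] := eqVneq u v.
  by rewrite e (negbTE (irr v)) in uv.
by move: (tot u v ne); rewrite uv /= => /negbTE.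
Qed.

Lemma edge_total u v : u != v -> E v u = ~~ E u v.
Proof. by case: tE => _ tot /tot; case: (E u v); case: (E v u). Qed.

Lemma card_cell_pivot c w : #|cell c w| = (before c w + after c w).+1.
Proof.
rewrite /before /after (cardsD1 w (cell c w)) /cell inE eqxx add1n; congr S.
rewrite -(cardsID [set u | E u w] ([set u | c u == c w] :\ w)); congr (_ + _); apply: eq_card => u.
  rewrite !inE; have [->|ne] /= := eqVneq u w; first by rewrite edge_irr andbF.
  by [].
rewrite !inE; have [->|ne] /= := eqVneq u w; first by rewrite edge_irr !andbF.
by rewrite (edge_total ne) andbC.
Qed.

Lemma pivot_out c w v : c v != c w -> pivot c w v = c v.
Proof. by rewrite /pivot => ->. Qed.

Lemma pivot_self c w : pivot c w w = c w + before c w.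
Proof. by rewrite /pivot !eqxx. Qed.

Lemma pivot_before c w v : c v = c w -> E v w -> pivot c w v = c w.
Proof.
rewrite /pivot => -> /[dup] vw /edge_asym ->; rewrite eqxx /=.
by case: eqVneq vw => // ->; rewrite edge_irr.
Qed.

Lemma pivot_after c w v :
  c v = c w -> E w v -> pivot c w v = c w + (before c w).+1.
Proof.
rewrite /pivot => -> /[dup] wv ->; rewrite eqxx /=.
by case: eqVneq wv => // ->; rewrite edge_irr.
Qed.

Lemma before_gt0 c w u : c u = c w -> E u w -> 0 < before c w.
Proof. by move=> cu uw; apply/card_gt0P; exists u; rewrite inE cu eqxx uw. Qed.

Lemma after_gt0 c w u : c u = c w -> E w u -> 0 < after c w.
Proof. by move=> cu uw; apply/card_gt0P; exists u; rewrite inE cu eqxx uw. Qed.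

Lemma edgeP u v : [\/ u = v, E u v | E v u].
Proof.
have [->|ne] := eqVneq u v; first by constructor 1.
by case uv : (E u v); [constructor 2|constructor 3; rewrite edge_total ?uv].
Qed.

(** The positivity of [before] and [after] lets arithmetic alone separate the labels of the three
    parts and place them inside the interval of the old cell. *)
Variant pivot_spec c w v : nat -> Prop :=
  | PivotOut of c v != c w : pivot_spec c w v (c v)
  | PivotSelf of v = w : pivot_spec c w v (c w + before c w)
  | PivotBefore of c v = c w & E v w & 0 < before c w : pivot_spec c w v (c w)
  | PivotAfter of c v = c w & E w v & 0 < after c w :
      pivot_spec c w v (c w + (before c w).+1).

Lemma pivotP c w v : pivot_spec c w v (pivot c w v).
Proof.
have [e|ne] := eqVneq (c v) (c w); last by rewrite pivot_out //; constructor.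
have [->|vw|wv] := edgeP v w; first by rewrite pivot_self; constructor.
  by rewrite pivot_before //; constructor=> //; apply: before_gt0 vw.
by rewrite pivot_after //; constructor=> //; apply: after_gt0 wv.
Qed.

(** The new labels stay among the [#|cell c w|] labels from [c w] on, and [spaced] keeps this
    interval apart from the other cells. *)
Lemma pivot_mono c w u v : spaced c -> c u < c v -> pivot c w u < pivot c w v.
Proof.
move=> [sp _] lt; have := card_cell_pivot c w.
have sz x y : c x = c y -> #|cell c x| = #|cell c y|.
  by move=> e; rewrite /cell e.
case: pivotP => [nu|eu|cu uw b|cu wu a];
  case: pivotP => [nv|ev|cv vw b'|cv wv a'] S //; subst; try lia;
  have := sp _ _ lt; rewrite ?(sz u w) ?(sz v w) // ?S; lia.
Qed.

Lemma pivot_inj c w u v : spaced c -> pivot c w u = pivot c w v -> c u = c v.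
Proof.
move=> sp e; case: (ltngtP (c u) (c v)) => // /(pivot_mono w sp); lia.
Qed.

Lemma pivot_ge c w v : c v <= pivot c w v.
Proof. by case: pivotP => *; subst; lia. Qed.

Lemma pivot_cell_sub c w v : spaced c -> cell (pivot c w) v \subset cell c v.
Proof.
by move=> sp; apply/fintype.subsetP=> u; rewrite !inE => /eqP/(pivot_inj sp)/eqP.
Qed.

Lemma pivot_spaced c w : spaced c -> spaced (pivot c w).
Proof.
move=> sp; have [sp1 sp2] := sp; have szw := card_cell_pivot c w.
have sz x y : c x = c y -> #|cell c x| = #|cell c y|.
  by move=> e; rewrite /cell e.
have scb v : c v = c w -> E v w -> #|cell (pivot c w) v| <= before c w.
  move=> cv vw; apply/subset_leq_card/fintype.subsetP => u; rewrite !inE.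
  move=> /eqP/[dup]/(pivot_inj sp) cu; rewrite cu cv eqxx /=.
  have b := before_gt0 cv vw; have ev := pivot_before cv vw.
  by rewrite ev; case: pivotP; rewrite ?cu ?cv ?eqxx // => *; lia.
have sca v : c v = c w -> E w v -> #|cell (pivot c w) v| <= after c w.
  move=> cv vw; apply/subset_leq_card/fintype.subsetP => u; rewrite !inE.
  move=> /eqP/[dup]/(pivot_inj sp) cu; rewrite cu cv eqxx /=.
  have ev := pivot_after cv vw.
  by rewrite ev; case: pivotP; rewrite ?cu ?cv ?eqxx // => *; lia.
have scs : #|cell (pivot c w) w| <= 1.
  apply: leq_trans (_ : #|[set w]| <= _); last by rewrite cards1.
  apply/subset_leq_card/fintype.subsetP => u; rewrite !inE.
  move=> /eqP/[dup]/(pivot_inj sp) cu; rewrite pivot_self.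
  by case: pivotP => [|->//||]; rewrite ?cu ?eqxx // => *; lia.
(* The interval of a new cell ends no later than that of the old one, so the gap to the next cell
   survives. *)
have top v : pivot c w v + #|cell (pivot c w) v| <= c v + #|cell c v|.
  have := subset_leq_card (pivot_cell_sub w v sp).
  case: pivotP => [nv|->|cv vw _|cv wv _] sub; first by lia.
  - by lia.
  - by have := scb v cv vw; rewrite cv (sz v w) //; lia.
  - by have := sca v cv wv; rewrite cv (sz v w) //; lia.
split=> [u v|v]; last exact: leq_trans (top v) (sp2 v).
move=> lt; case: (ltngtP (c u) (c v)) => [cuv|cvu|e].
- by apply: leq_trans (top u) (leq_trans (sp1 _ _ cuv) (pivot_ge _ _ _)).
- by have := pivot_mono w sp cvu; lia.
move: lt; case: (pivotP c w u) => [nu|eu|cu uw b|cu wu a];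
  case: (pivotP c w v) => [nv|ev|cv vw b'|cv wv a']; subst; try lia.
all: have := scb _ cu uw; lia.
Qed.

End Pivots.

Lemma card_sum_bool (T : finType) (P : pred T) :
  #|[set x | P x]| = \sum_x P x.
Proof. by rewrite -sum1dep_card big_mkcond; apply: eq_bigr => x _; case: (P x). Qed.

(** * The effect of one pivot on cell sizes and on back edges *)

Section Potentials.

Variables (n : nat) (E : rel 'I_n).
Hypothesis tE : tournament E.
Implicit Types (c : 'I_n -> nat) (u v w : 'I_n).

Local Notation pivot := (pivot E).

(* The pivots [w] and the vertices [u] on the same side of the cell of [v] are
   counted with their symmetric pairs: two vertices that both follow [v], or
   both precede it, are separated from each other in one of the two orders. *)
Lemma sum_card_cell_pivot c v :
  spaced c -> 1 < #|cell c v| ->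
  16 * \sum_(w in cell c v) #|cell (pivot c w) v| <= 15 * #|cell c v| ^ 2.
Proof.
move=> sp m1; set C := cell c v.
pose A w u : nat := pivot c w u == pivot c w v.
have cA w : #|cell (pivot c w) v| = \sum_(u in C) A w u.
  rewrite /cell card_sum_bool [RHS]big_mkcond; apply: eq_bigr => u _.
  rewrite /C !inE /A; case: (c u =P c v) => // ne.
  by case: eqP => // /(pivot_inj tE sp).
rewrite (eq_bigr _ (fun w _ => cA w)).
have pw w u : w \in C -> u \in C ->
    A w u + A u w + (E v w && E v u) + (E w v && E u v) <= 2.
  rewrite /C !inE => /eqP cw /eqP cu.
  have [/andP[vw vu]|] := boolP (E v w && E v u).
    rewrite !(edge_asym tE vw) /A (pivot_before tE _ vw) // (pivot_before tE _ vu) //=.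
    have [->|uw|wu] := edgeP tE u w.
    - by rewrite pivot_self; have := before_gt0 (esym cw) vw; lia.
    - by rewrite (pivot_after tE _ uw) ?cw ?cu //; lia.
    - by rewrite (pivot_after tE _ wu) ?cw ?cu //; lia.
  have [/andP[vw vu]|] := boolP (E w v && E u v); last by move=> _ _; rewrite /A; lia.
  rewrite /A (pivot_after tE _ vw) // (pivot_after tE _ vu) //= => _.
  have [->|uw|wu] := edgeP tE u w.
  - by rewrite pivot_self; lia.
  - by rewrite (pivot_before tE _ uw) ?cw ?cu //; lia.
  - by rewrite (pivot_before tE _ wu) ?cw ?cu //; lia.
have sq (P : pred 'I_n) :
    \sum_(w in C) \sum_(u in C) (P w && P u) = (\sum_(w in C) P w) ^ 2.
  rewrite -mulnn big_distrl; apply: eq_bigr => w _ /=; rewrite big_distrr.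
  by apply: eq_bigr => u _ /=; rewrite mulnb.
have tot : \sum_(w in C) \sum_(u in C)
   (A w u + A u w + (E v w && E v u) + (E w v && E u v)) <= 2 * #|C| ^ 2.
  apply: leq_trans (_ : \sum_(w in C) \sum_(u in C) 2 <= _).
    by apply: leq_sum => w wC; apply: leq_sum => u uC; apply: pw.
  by rewrite !sum_nat_const; lia.
have := card_cell_pivot tE c v; rewrite /before /after -/C => sC.
have out (P : pred 'I_n) : \sum_u ((c u == c v) && P u) = \sum_(u in C) P u.
  by rewrite [RHS]big_mkcond; apply: eq_bigr => u _; rewrite inE; case: eqP.
move: sC; rewrite (card_sum_bool (fun u => (c u == c v) && E u v)).
rewrite (card_sum_bool (fun u => (c u == c v) && E v u)) !out => sC; move: tot.
under eq_bigr do rewrite !big_split /=.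
rewrite !big_split /= sq (sq (fun w => E w v)) [X in _ + X + _ + _ <= _]exchange_big /=.
move: (\sum_(i in C) \sum_(u in C) A i u) sC m1 => S.
move: (\sum_(u in C) E v u) (\sum_(u in C) E u v) => o i sC m1 H.
(* With [m = o + i + 1] vertices in the cell, [H] reads [2 * S + o ^ 2 + i ^ 2 <= 2 * m ^ 2]. Since
   [o ^ 2 + i ^ 2 >= (m - 1) ^ 2 / 2 >= m ^ 2 / 8] for [m >= 2], the factor 15/16 results. *)
rewrite -/C sC in m1 H *; have : 0 < o + i by lia.
have := nat_Cauchy o i; nia.
Qed.

(** Truncation at [L] makes the expectation decay geometrically at a fixed rate, while a nonzero
    value still witnesses a cell that is too large. *)
Definition big_cell (L : nat) c v : nat :=
  if L < #|cell c v| then #|cell c v| else 0.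

(** Pivots outside the cell of [v] do not enlarge it, and those inside save [m ^ 2 / 16] in total,
    where [m > L] is its size. For a uniform pivot this is a decay factor [1 - L / (16 * n)]. *)
Lemma sum_big_cell (L : nat) c v :
  0 < L -> spaced c ->
  16 * \sum_w big_cell L (pivot c w) v + L * big_cell L c v
    <= 16 * n * big_cell L c v.
Proof.
move=> L0 sp; rewrite /big_cell.
have sub w := subset_leq_card (pivot_cell_sub tE w v sp).
case: ltnP => [Lm|mL]; last first.
  rewrite big1 ?muln0 // => w _; rewrite ltnNge (leq_trans (sub w) mL) //.
set m := #|cell c v| in Lm sub *.
apply: leq_trans (_ : 16 * (\sum_w #|cell (pivot c w) v|) + L * m <= _).
  by rewrite leq_add2r leq_mul2l /=; apply: leq_sum => w _; case: ifP.
have := sum_card_cell_pivot sp (leq_ltn_trans L0 Lm).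
rewrite -/m [in X in _ -> X](bigID (mem (cell c v))) /=.
have : \sum_(w | w \notin cell c v) #|cell (pivot c w) v| <= (n - m) * m.
  apply: leq_trans (_ : \sum_(w | w \notin cell c v) m <= _).
    exact: leq_sum.
  rewrite sum_nat_const leq_mul2r; apply/orP; right.
  have e : m + #|[predC cell c v]| = n by rewrite cardC card_ord.
  have -> : n - m = #|[predC cell c v]| by lia.
  exact: leqnn.
have : m <= n by rewrite -[n in _ <= n]card_ord max_card.
set a := \sum_(w in cell c v) _; set b := \sum_(w | w \notin cell c v) _; nia.
Qed.

Definition decided_back c : nat :=
  #|[set e : 'I_n * 'I_n | E e.1 e.2 && (c e.2 < c e.1)]|.

Section Reference.

Variable s : 'S_n.

Definition undecided_back c : nat :=
  #|[set e | (e \in back_edges E s) && (c e.1 == c e.2)]|.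

Let cyclic c u v w : bool :=
  [&& c u == c w, c v == c w, E u v, E v w & E w u].

Let bk u v : bool := E u v && (s v < s u).

Lemma cyclic_rot c u v w : cyclic c u v w = cyclic c v w u.
Proof.
by rewrite /cyclic; lia.
Qed.

(** Positions in [s] cannot increase all the way around a cyclic triangle, so one of its three edges
    goes back; the three rotations contribute equal sums. *)
Lemma sum_cyclic c :
  \sum_u \sum_v \sum_w cyclic c u v w <=
  3 * \sum_u \sum_v \sum_w (bk u v && cyclic c u v w).
Proof.
set t := (X in _ <= 3 * X).
have r1 : \sum_u \sum_v \sum_w (bk v w && cyclic c u v w) = t.
  rewrite exchange_big /=.
  transitivity (\sum_v \sum_w \sum_u (bk v w && cyclic c u v w)).
    by apply: eq_bigr => v _; rewrite exchange_big.
  do 3 apply: eq_bigr => ? _; by rewrite cyclic_rot.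
have r2 : \sum_u \sum_v \sum_w (bk w u && cyclic c u v w) = t.
  transitivity (\sum_u \sum_w \sum_v (bk w u && cyclic c u v w)).
    by apply: eq_bigr => v _; rewrite exchange_big.
  rewrite exchange_big /=; do 3 apply: eq_bigr => ? _; by rewrite -cyclic_rot.
rewrite (_ : 3 * t = t + t + t); last by lia.
rewrite -{2}r1 -{2}r2 /t -!big_split; apply: leq_sum => u _.
rewrite -!big_split; apply: leq_sum => v _; rewrite -!big_split.
apply: leq_sum => w _ /=; rewrite /bk.
have [|//] := boolP (cyclic c u v w); rewrite /cyclic => /and5P[_ _ uv -> ->].
have : s u != s v :> nat.
  by apply/eqP => /ord_inj/perm_inj e; rewrite e edge_irr in uv.
by rewrite uv /= !andbT; lia.
Qed.

(** An edge from [u] to [v] inside a cell is newly decided backwards only if [v] goes before the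
    pivot and [u] after it, which closes a cyclic triangle with apex [w]. *)
Lemma decided_back_pivot c w :
  spaced c ->
  decided_back (pivot c w) <= decided_back c + \sum_u \sum_v cyclic c u v w.
Proof.
move=> sp; rewrite pair_big /= -card_sum_bool.
apply: leq_trans (leq_card_setU _ _).1; apply/subset_leq_card/fintype.subsetP.
move=> [u v]; rewrite !inE /= => /andP[uv lt]; rewrite uv /=.
case: (ltngtP (c u) (c v)) => //= [/(pivot_mono tE w sp)|e]; first by lia.
have := edge_asym tE uv; move: lt; rewrite /cyclic uv /=.
case: (pivotP tE c w u); case: (pivotP tE c w v) => *; subst; lia.
Qed.

Lemma undecided_back_pivot c w :
  spaced c ->
  undecided_back (pivot c w) +
    \sum_u \sum_v ([&& bk u v & c u == c v] && [|| cyclic c u v w, w == u | w == v])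
  <= undecided_back c.
Proof.
move=> sp; rewrite pair_big /= -card_sum_bool /undecided_back.
rewrite -(cardsID [set e | pivot c w e.1 == pivot c w e.2] [set e | _ & c e.1 == c e.2]).
apply: leq_add; apply/subset_leq_card/fintype.subsetP => -[u v]; rewrite !inE /= -/(bk u v).
  by move=> /andP[-> /eqP e]; rewrite e (pivot_inj tE sp e) !eqxx.
move=> /andP[/andP[/[dup] /andP[uv _] -> /eqP e] H]; rewrite e eqxx /= andbT.
have vu := edge_asym tE uv; have irr := edge_irr tE w.
case/or3P: H => [/and5P[/eqP cu /eqP cv _ vw wu]|/eqP ew|/eqP ew].
- by rewrite (pivot_after tE cu wu) (pivot_before tE cv vw); lia.
- by subst w; rewrite pivot_self (pivot_after tE _ uv) //; lia.
- by subst w; rewrite pivot_self (pivot_before tE _ uv) //; have := before_gt0 e uv; lia.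
Qed.

(** Let [U] be the undecided back edges and [t] the pairs of such an edge with the apex of a cyclic
    triangle on it. Over all pivots, at most [3 * t] back edges are created, while [U] loses at
    least [t + 2 * U]; with weight 3 this pays for them and leaves [6 * U]. *)
Lemma sum_pivot_cost c :
  spaced c ->
  \sum_w (decided_back (pivot c w) + 3 * undecided_back (pivot c w))
    + 6 * undecided_back c <= n * (decided_back c + 3 * undecided_back c).
Proof.
move=> sp.
have dr k (f : 'I_n -> nat) : \sum_i k * f i = k * \sum_i f i.
  by rewrite big_distrr.
pose x u v := bk u v && (c u == c v).
have U : \sum_u \sum_v x u v = undecided_back c.
  rewrite pair_big /= -card_sum_bool /undecided_back; apply: eq_card => -[u v].
  by rewrite !inE.
have out (f : 'I_n -> 'I_n -> 'I_n -> nat) :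
    \sum_w \sum_u \sum_v f u v w = \sum_u \sum_v \sum_w f u v w.
  rewrite exchange_big /=; apply: eq_bigr => u _; exact: exchange_big.
(* The three ways to separate [u] from [v] exclude each other, as no vertex has an edge to itself,
   so the disjunction turns into a sum. *)
have S : \sum_w \sum_u \sum_v (x u v && [|| cyclic c u v w, w == u | w == v])
    = \sum_u \sum_v \sum_w (bk u v && cyclic c u v w) + 2 * undecided_back c.
  rewrite out -U -dr /=.
  have -> : \sum_u 2 * \sum_v x u v = \sum_u \sum_v \sum_w x u v * ((w == u) + (w == v)).
    apply: eq_bigr => u _; rewrite -dr; apply: eq_bigr => v _ /=.
    rewrite (dr (x u v) (fun w => (w == u) + (w == v))) big_split /=.
    have one (i : 'I_n) : \sum_w (w == i) = 1.
      by rewrite (bigD1 i) //= eqxx big1 // => j /negbTE ->.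
    by rewrite !one mulnC.
  rewrite -big_split; apply: eq_bigr => u _; rewrite -big_split.
  apply: eq_bigr => v _; rewrite -big_split; apply: eq_bigr => w _ /=.
  have [b|] := boolP (bk u v); last by rewrite /x => /negbTE ->.
  rewrite /x b /=; case/andP: b => uv _.
  have irr v := edge_irr tE v.
  have [wu|wu] := eqVneq w u; have [wv|wv] := eqVneq w v;
    subst=> //; rewrite /cyclic ?irr in uv *.
  all: try lia.
have D : \sum_w decided_back (pivot c w) <=
    n * decided_back c + \sum_u \sum_v \sum_w cyclic c u v w.
  apply: leq_trans (leq_sum _ (fun w _ => decided_back_pivot w sp)) _.
rewrite big_split /= sum_nat_const card_ord leq_add2l.
  by rewrite (out (fun u v w => cyclic c u v w)).
have F : \sum_w undecided_back (pivot c w) +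
    (\sum_u \sum_v \sum_w (bk u v && cyclic c u v w) + 2 * undecided_back c) <=
    n * undecided_back c.
  rewrite -S -big_split /=.
  apply: leq_trans (leq_sum _ (fun w _ => undecided_back_pivot w sp)) _.
  by rewrite sum_nat_const card_ord leqnn.
rewrite big_split /= dr mulnDr [n * (3 * _)]mulnCA; have := sum_cyclic c.
move: D F; clear; move: (\sum_w decided_back _) (\sum_w undecided_back _) => d f.
by move: (\sum_u _) (\sum_u _) => t3 tb; lia.
Qed.

End Reference.
End Potentials.

(** * Expectation over samples *)

Local Open Scope ring_scope.

Section Mean.

Variables (R : realType) (T : finType).
Implicit Types (k : nat) (F G : seq T -> R).

(** Expectation over [k] independent uniform elements of [T]. Lists instead of tuples make it easy
    to split the sample into consecutive parts. *)
Fixpoint mean k F : R :=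
  if k is k'.+1 then (\sum_x mean k' (fun l => F (x :: l))) / #|T|%:R
  else F [::].

Lemma mean_ext k F G : (forall l, size l = k -> F l = G l) -> mean k F = mean k G.
Proof.
elim: k F G => [|k IH] F G FG /=; first exact: FG.
by congr (_ / _); apply: eq_bigr => x _; apply: IH => l sl; apply: FG; rewrite /= sl.
Qed.

Lemma mean_le k F G : (forall l, size l = k -> F l <= G l) -> mean k F <= mean k G.
Proof.
elim: k F G => [|k IH] F G FG /=; first exact: FG.
rewrite ler_wpM2r ?invr_ge0 // ler_sum // => x _.
by apply: IH => l sl; apply: FG; rewrite /= sl.
Qed.

Lemma meanD k F G : mean k (fun l => F l + G l) = mean k F + mean k G.
Proof.
by elim: k F G => [|k IH] F G //=; rewrite -mulrDl -big_split; under eq_bigr do rewrite IH.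
Qed.

Lemma meanZ k (a : R) F : mean k (fun l => a * F l) = a * mean k F.
Proof.
elim: k F => [|k IH] F //=; under eq_bigr do rewrite IH.
by rewrite -mulr_sumr mulrA.
Qed.

Lemma mean_sum k (I : finType) (F : I -> seq T -> R) :
  mean k (fun l => \sum_i F i l) = \sum_i mean k (F i).
Proof.
elim: k F => [|k IH] F //=; under eq_bigr do rewrite IH.
by rewrite exchange_big /= mulr_suml.
Qed.

Lemma mean_cat k1 k2 F :
  mean (k1 + k2) F = mean k1 (fun l1 => mean k2 (fun l2 => F (l1 ++ l2))).
Proof.
elim: k1 F => [|k1 IH] F //=.
by congr (_ / _); apply: eq_bigr => x _; rewrite IH.
Qed.

Lemma mean_cst k (a : R) : (0 < #|T|)%N -> mean k (fun=> a) = a.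
Proof.
move=> T0; elim: k => [|k IH] //=; under eq_bigr do rewrite IH.
by rewrite sumr_const -[_ *+ _]mulr_natr mulfK // pnatr_eq0 -lt0n.
Qed.

Lemma mean_take k1 k2 F : (0 < #|T|)%N ->
  mean (k1 + k2) (fun l => F (take k1 l)) = mean k1 F.
Proof.
move=> T0; rewrite mean_cat; apply: mean_ext => l sl.
by rewrite -[RHS](mean_cst k2 _ T0); apply: mean_ext => l' _; rewrite -sl take_size_cat.
Qed.

Lemma mean_tuple k F :
  mean k F = (\sum_(t : k.-tuple T) F t) / #|T|%:R ^+ k.
Proof.
elim: k F => [|k IH] F /=.
  by rewrite expr0 divr1 (big_pred1 ([tuple] : 0.-tuple T)) // => t; apply/esym/eqP; exact: tuple0.
rewrite exprSr invfM mulrA; congr (_ / _).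
under eq_bigr do rewrite IH.
rewrite -mulr_suml; congr (_ / _).
rewrite pair_bigA /= (reindex (fun t : k.+1.-tuple T => (thead t, [tuple of behead t]))) /=.
  by apply: eq_bigr => t _; congr F; case/tupleP: t => x t /=.
exists (fun xt : T * k.-tuple T => [tuple of xt.1 :: xt.2]) => [t _|[x t] _].
  by case/tupleP: t => x t; apply: val_inj.
by congr pair; apply: val_inj.
Qed.

End Mean.

(** * Uniform samples from fair coins *)

Section Samples.

Variable R : realType.

Definition bits_value (a : nat) (l : seq bool) : nat :=
  foldl (fun x (y : bool) => (2 * x + y)%N) a l.

(** Bits are read from the most significant one; the accumulator [a] is there for the induction. *)
Lemma mean_bits_value b a (G : nat -> R) :
  mean b (fun l => G (bits_value a l)) =
  (\sum_(x < 2 ^ b) G (a * 2 ^ b + x)%N) / (2 ^ b)%:R.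
Proof.
elim: b a => [|b IH] a /=.
  by rewrite expn0 big_ord1 muln1 addn0 divr1.
rewrite big_bool /= !IH card_bool.
have -> : (2 ^ b.+1 = 2 ^ b + 2 ^ b)%N by rewrite expnS; lia.
rewrite big_split_ord /=.
have -> : (2 ^ b + 2 ^ b)%:R = (2 ^ b)%:R * 2 :> R by rewrite natrD; ring.
rewrite -mulrDl invfM mulrA; congr (_ / _ / _).
rewrite addrC; congr (_ + _); apply: eq_bigr => i _; congr G; rewrite /= ?addn0; nia.
Qed.

Definition sample (b : nat) (r : seq bool) (k : nat) : nat :=
  bits_value 0 (take b (drop (k * b) r)).

Definition samples b r k : seq nat := mkseq (sample b r) k.

(** Disjoint blocks of [b] coins give independent samples, and the surplus coins average out. *)
Lemma mean_samples b k m (F : seq nat -> R) : (k * b <= m)%N ->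
  mean m (fun r => F (samples b r k)) =
  mean k (fun l : seq 'I_(2 ^ b) => F (map val l)).
Proof.
have c2 : (0 < #|{: bool}|)%N by rewrite card_bool.
elim: k m F => [|k IH] m F km /=; first exact: (mean_cst m (F [::]) c2).
rewrite mulSn in km; rewrite -(subnKC (leq_trans (leq_addr _ _) km)) mean_cat.
transitivity (mean b (fun r1 => mean (m - b)
    (fun r2 => F (bits_value 0 r1 :: samples b r2 k)))).
  apply: mean_ext => r1 s1; apply: mean_ext => r2 _; congr F.
  rewrite /samples /mkseq /= /sample mul0n drop0 take_cat s1 ltnn subnn take0 cats0.
  congr cons; rewrite -[1%N]addn0 iotaDl -map_comp; apply: eq_map => i /=.
  by rewrite mulnDl mul1n drop_cat s1 ltnNge leq_addr /= addKn.
rewrite (mean_bits_value b 0 (fun x => mean (m - b) (fun r2 => F (x :: samples b r2 k)))).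
rewrite card_ord; congr (_ / _); apply: eq_bigr => x _.
by rewrite mul0n add0n -(IH (m - b)%N (fun l => F (val x :: l))) //; lia.
Qed.

Lemma expect_coinsE m (F : seq bool -> R) :
  expect_coins (fun r : m.-tuple bool => F r) = mean m F.
Proof. by rewrite mean_tuple card_bool. Qed.

End Samples.

(** * The random sequence of pivots *)

Section Process.

Variables (R : realType) (n : nat) (E : rel 'I_n) (N : nat).
Hypotheses (tE : tournament E) (nN : (n <= N)%N) (N0 : (0 < N)%N).

(** Samples are uniform below a power of two; one that names no vertex is skipped. *)
Definition pivot_at (c : 'I_n -> nat) (x : nat) : 'I_n -> nat :=
  oapp (pivot E c) c (insub x).

Definition pivots (xs : seq nat) : 'I_n -> nat := foldl pivot_at (fun=> 0%N) xs.

Lemma pivot_at_spaced c x : spaced c -> spaced (pivot_at c x).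
Proof. by move=> sp; rewrite /pivot_at; case: insub => //= w; apply: pivot_spaced. Qed.

Lemma pivots_spaced c xs : spaced c -> spaced (foldl pivot_at c xs).
Proof. by elim: xs c => //= x xs IH c sp; apply/IH/pivot_at_spaced. Qed.

Lemma spaced0 : spaced (fun _ : 'I_n => 0%N).
Proof.
split=> // v; rewrite add0n -[leqRHS]card_ord; exact: max_card.
Qed.

Lemma sum_pivot_at (f : ('I_n -> nat) -> nat) c :
  (\sum_(x < N) f (pivot_at c x) = \sum_w f (pivot E c w) + (N - n) * f c)%N.
Proof.
rewrite -(big_mkord xpredT (fun x => f (pivot_at c x))) (big_cat_nat _ nN) //=.
congr (_ + _)%N.
  rewrite big_mkord; apply: eq_bigr => w _.
  by rewrite /pivot_at; case: insubP => [w' _ /val_inj ->|]; rewrite ?ltn_ord.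
rewrite (eq_big_nat _ _ (F2 := fun=> f c)) ?sum_nat_const_nat // => x /andP[nx _].
by rewrite /pivot_at insubF // ltnNge nx.
Qed.

(** Iterates a one-step contraction of a potential [f]. It serves for large cells with [rho < 1]
    and, with [rho = 1], for the supermartingale. *)
Lemma mean_decay (rho : R) (f : ('I_n -> nat) -> R) k c :
  0 <= rho ->
  (forall c, spaced c -> \sum_(x < N) f (pivot_at c x) <= N%:R * (rho * f c)) ->
  spaced c ->
  mean k (fun l : seq 'I_N => f (foldl pivot_at c (map val l))) <= rho ^+ k * f c.
Proof.
move=> rho0 dec; elim: k c => [|k IH] c sp /=; first by rewrite expr0 mul1r.
rewrite card_ord ler_pdivrMr ?ltr0n //.
apply: le_trans (_ : \sum_(x < N) rho ^+ k * f (pivot_at c x) <= _).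
  by apply: ler_sum => x _; apply: IH; apply: pivot_at_spaced.
rewrite -mulr_sumr exprSr -!mulrA [_ * N%:R]mulrC ler_wpM2l ?exprn_ge0 //.
by rewrite mulrCA dec.
Qed.

End Process.

(** * The expected number of back edges, failures included *)

Section Cost.

Variables (R : realType) (n : nat) (E : rel 'I_n) (p b m : nat).
Hypotheses (tE : tournament E) (nN : (n <= 2 ^ b)%N).
Hypotheses (b0 : (0 < b)%N) (m0 : (0 < m)%N) (p0 : (0 < p)%N).

Local Notation N := (2 ^ b)%N.

(* The factor [(p + 5) * b] makes the expected cost of failures, at most
   [p * n ^ 4 / 2 ^ ((p + 5) * b)], smaller than [1 / 2 ^ b]. *)
Definition pass_samples (i : nat) : nat := (32 * ((p + 5) * b) * m ^ i.+1)%N.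
Definition total_samples (i : nat) : nat := (\sum_(j < i) pass_samples j)%N.
(** The size allowed after [i] passes. Once [2 ^ b < 2 * m ^ p], the bound for [i = p] is 1, so the
    cells end as singletons. *)
Definition cell_bound (i : nat) : nat := (N %/ (2 * m ^ i)).+1.

Definition balanced (xs : seq nat) : bool :=
  [forall i : 'I_p, forall v,
    (#|cell (pivots E (take (total_samples i.+1) xs)) v| <= cell_bound i.+1)%N].

(** On failure, [n ^ 2] bounds the back edges of whatever ordering is returned. *)
Definition cost_bound (xs : seq nat) : nat :=
  if balanced xs then decided_back E (pivots E xs) else (n ^ 2)%N.

(** A form of Bernoulli's inequality; [y = 1 / q] and [k = q] give [(1 - 1 / q) ^ q <= 1 / 2].
    Passing from [k] to [k + 1], the factors differ by exactly [(k + 1) * y ^ 2]. *)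
Lemma expr_1Bq (y : R) k : 0 <= y <= 1 -> (1 - y) ^+ k * (1 + k%:R * y) <= 1.
Proof.
move=> /andP[y0 y1]; elim: k => [|k IH]; first by rewrite mul0r addr0 mulr1.
apply: le_trans IH; rewrite exprSr -mulrA ler_wpM2l ?exprn_ge0 ?subr_ge0 //.
rewrite -subr_ge0 (_ : _ - _ = k.+1%:R * y ^+ 2) ?mulr_ge0 ?sqr_ge0 //.
by rewrite -addn1 natrD; ring.
Qed.

Lemma expr_1Bq_half q k : (0 < q)%N -> (1 - q%:R^-1 : R) ^+ (q * k) <= 2^-1 ^+ k.
Proof.
move=> q0; have q1 : 1 <= (q%:R : R) by rewrite ler1n.
have y01 : 0 <= (q%:R^-1 : R) <= 1.
  by rewrite invr_ge0 ler0n /= invf_le1 // ltr0n.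
rewrite exprM lerXn2r ?nnegrE ?exprn_ge0 ?invr_ge0 ?subr_ge0 //; first by case/andP: y01.
have := expr_1Bq q y01; rewrite mulfV ?pnatr_eq0 -?lt0n //.
by set z := _ ^+ q => ?; lra.
Qed.

(** One sample contracts the potential by [rho <= 1 - 1 / q], since [16 * N <= q * L]. Pass [i]
    alone draws [q * Q] samples, which yields the factor [2 ^ -Q] on an initial value of at most
    [n]. *)
Lemma mean_big_cell i v :
  mean (total_samples i.+1) (fun l : seq 'I_N =>
    (big_cell (cell_bound i.+1) (pivots E (map val l)) v)%:R : R) <=
  n%:R * 2^-1 ^+ ((p + 5) * b).
Proof.
set L := cell_bound i.+1; set Q := ((p + 5) * b)%N; set q := (32 * m ^ i.+1)%N.
have N0 : (0 < N)%N by rewrite expn_gt0.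
have NR : 0 < (N%:R : R) by rewrite ltr0n.
have q0 : (0 < q)%N by rewrite muln_gt0 expn_gt0 m0.
have mi0 : (0 < m ^ i.+1)%N by rewrite expn_gt0 m0.
have qL : (16 * N <= q * L)%N.
  by have := ltn_ceil N (_ : 0 < 2 * m ^ i.+1)%N; rewrite /L /cell_bound /q; lia.
have L16 : (L <= 16 * N)%N.
  by have := leq_div N (2 * m ^ i.+1); rewrite /L /cell_bound; lia.
pose rho : R := 1 - L%:R / (16 * N)%:R.
have NN0 : 0 < ((16 * N)%:R : R) by rewrite ltr0n muln_gt0.
have rho0 : 0 <= rho by rewrite subr_ge0 ler_pdivrMr // mul1r ler_nat.
have rho1 : rho <= 1 by rewrite gerBl divr_ge0.
have rhoq : rho <= 1 - q%:R^-1.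
  rewrite lerD2l lerN2 ler_pdivlMr // mulrC ler_pdivrMr ?ltr0n //.
  by rewrite -natrM ler_nat [X in (_ <= X)%N]mulnC.
have mQ : (q * Q <= total_samples i.+1)%N.
  by rewrite /total_samples big_ord_recr /= /pass_samples -/Q /q; lia.
apply: le_trans (@mean_decay R n E N tE N0 rho (fun c => (big_cell L c v)%:R)
  (total_samples i.+1) (fun=> 0%N) rho0 _ (spaced0 n)) _; last first.
  rewrite mulrC ler_pM ?exprn_ge0 //.
    by rewrite ler_nat /big_cell; case: ifP => // _; rewrite -[leqRHS]card_ord max_card.
  apply: le_trans (ler_wiXn2l rho0 rho1 mQ) _.
  apply: le_trans (expr_1Bq_half Q q0).
  by rewrite lerXn2r ?nnegrE // subr_ge0 invf_le1 ?ltr0n // ler1n.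
move=> c sp; rewrite -natr_sum (sum_pivot_at E nN (fun c => big_cell L c v)).
have := sum_big_cell tE v (ltn0Sn _ : 0 < L)%N sp.
set S := (\sum_w _)%N; set X := big_cell L c v => H.
rewrite -(@ler_pM2l _ 16) // -natrM.
have -> : 16 * (N%:R * (rho * X%:R)) = (16 * N * X)%:R - (L * X)%:R :> R.
  rewrite !natrM /rho natrM; field.
  by rewrite lt0r_neq0.
rewrite lerBrDr -natrD ler_nat.
by rewrite mulnDr addnAC; nia.
Qed.

Lemma mean_decided_back (s : 'S_n) : (0 < n)%N ->
  mean (total_samples p) (fun l : seq 'I_N =>
     (decided_back E (pivots E (map val l)))%:R : R)
  + 6 * #|back_edges E s|%:R / N%:R <= 3 * #|back_edges E s|%:R.
Proof.
move=> n0.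
have N0 : (0 < N)%N by rewrite expn_gt0.
have NR : 0 < (N%:R : R) by rewrite ltr0n.
have tp : (0 < total_samples p)%N.
  rewrite /total_samples; case: p p0 => // p' _; rewrite big_ord_recr /= /pass_samples.
  by apply/leq_trans/leq_addl; rewrite !muln_gt0 b0 expn_gt0 m0 addnS.
pose f c := (decided_back E c + 3 * undecided_back E s c)%N.
have u0 : undecided_back E s (fun=> 0%N) = #|back_edges E s|.
  by apply: eq_card => e; rewrite inE eqxx andbT.
have f0 : f (fun=> 0%N) = (3 * #|back_edges E s|)%N.
  by rewrite /f u0 /decided_back eq_card0 // => e; rewrite inE ltnn andbF.
have dec c : spaced c -> (\sum_(x < N) f (pivot_at E c x)
    + 6 * undecided_back E s c <= N * f c)%N.
  move=> sp; rewrite (sum_pivot_at E nN f); have := sum_pivot_cost tE s sp.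
  rewrite -(leq_add2r ((N - n) * f c)) -mulnDl subnKC //; apply: leq_trans.
  by rewrite addnAC.
have step1 k c : spaced c ->
  mean k (fun l : seq 'I_N => (f (foldl (pivot_at E) c (map val l)))%:R : R) <= (f c)%:R.
  move=> sp; have := @mean_decay R n E N tE N0 1 (fun c => (f c)%:R) k c ler01.
  rewrite expr1n mul1r; apply=> // c' sp'.
  rewrite mul1r -natr_sum -natrM ler_nat; apply: leq_trans (dec c' sp').
  exact: leq_addr.
(* Only the first sample, drawn while every back edge of [s] is undecided, is credited with its
   gain; the later ones merely do not raise the potential. *)
rewrite -(prednK tp) /= card_ord -mulrDl ler_pdivrMr //.
have := dec _ (spaced0 n); rewrite f0 u0 -(ler_nat R) natrD natr_sum !natrM [N%:R * _]mulrC.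
apply: le_trans; rewrite lerD2r; apply: ler_sum => x _.
apply: le_trans (step1 _ _ (pivot_at_spaced tE x (spaced0 n))).
by apply: mean_le => l _; rewrite ler_nat leq_addr.
Qed.

(** Markov's inequality with a union bound: a failure costs [n ^ 2] and makes some [X i v] at least
    1, so failures cost at most [n ^ 4 * p / 2 ^ Q] in expectation. The gain of the first step is at
    least [1 / N], as a back edge exists, and covers this. *)
Theorem mean_cost_bound (s : 'S_n) : (0 < #|back_edges E s|)%N ->
  mean (total_samples p) (fun l : seq 'I_N => (cost_bound (map val l))%:R : R)
  <= 3 * #|back_edges E s|%:R.
Proof.
move=> be0.
have n0 : (0 < n)%N.
  by have /card_gt0P[[u _] _] := be0; apply: leq_ltn_trans (ltn_ord u).
have N0 : (0 < N)%N by rewrite expn_gt0.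
have NR : 0 < (N%:R : R) by rewrite ltr0n.
pose X i v (l : seq 'I_N) : R :=
  (big_cell (cell_bound i.+1) (pivots E (take (total_samples i.+1) (map val l))) v)%:R.
apply: le_trans (_ : mean (total_samples p) (fun l : seq 'I_N =>
     (decided_back E (pivots E (map val l)))%:R +
     n%:R ^+ 2 * \sum_(i < p) \sum_v X i v l) <= _).
  apply: mean_le => l _; rewrite /cost_bound; case: ifPn => [_|].
    by rewrite lerDl mulr_ge0 ?exprn_ge0 ?sumr_ge0 // => i _; rewrite sumr_ge0.
  rewrite negb_forall => /existsP[i]; rewrite negb_forall => /existsP[v].
  rewrite -ltnNge => big; apply: le_trans (_ : n%:R ^+ 2 * X i v l <= _).
    rewrite natrX ler_peMr ?exprn_ge0 // /X /big_cell big ler1n.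
    exact: leq_ltn_trans big.
  rewrite -[leLHS]add0r lerD // ler_wpM2l ?exprn_ge0 //.
  rewrite (bigD1 i) //= (bigD1 v) //= -!addrA lerDl addr_ge0 ?sumr_ge0 //.
  by move=> j _; rewrite sumr_ge0.
rewrite meanD meanZ mean_sum; apply: le_trans (mean_decided_back s n0).
rewrite lerD2l.
apply: le_trans (_ : n%:R ^+ 2 * \sum_(i < p) \sum_(v : 'I_n)
   (n%:R * 2^-1 ^+ ((p + 5) * b)) <= _).
  rewrite ler_wpM2l ?exprn_ge0 //; apply: ler_sum => i _.
  rewrite mean_sum; apply: ler_sum => v _; rewrite /X.
  have le : (total_samples i.+1 <= total_samples p)%N.
    rewrite /total_samples -!(big_mkord xpredT pass_samples).
    by rewrite (big_cat_nat _ (ltn_ord i)) //= leq_addr.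
  rewrite -(subnKC le).
  under mean_ext do rewrite -map_take.
  rewrite (mean_take _ _ (fun l : seq 'I_N =>
    (big_cell (cell_bound i.+1) (pivots E (map val l)) v)%:R)) ?card_ord //.
  exact: mean_big_cell.
rewrite !sumr_const !card_ord.
(* The exponent splits into [p * b] for [p], [4 * b] for [n ^ 4] and [b] for [N]. *)
set Q := ((p + 5) * b)%N; have small : (n ^ 4 * p * N <= 2 ^ Q)%N.
  rewrite /Q mulnDl expnD mulnAC [leqLHS]mulnC leq_mul //.
    by rewrite (leq_trans (ltnW (ltn_expl p (ltnSn 1)))) // leq_exp2l // leq_pmulr.
  by rewrite (mulnDl 4 1) mul1n expnD leq_mul2r (mulnC 4) expnM leq_exp2r // nN orbT.
apply: le_trans (_ : N%:R^-1 <= _); last first.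
  by rewrite ler_peMl ?invr_ge0 // -natrM ler1n muln_gt0 be0.
rewrite -[leRHS]div1r ler_pdivlMr // exprVn.
rewrite -[n%:R / _ *+ n]mulr_natr -[_ *+ p]mulr_natr.
rewrite (_ : _ * N%:R = (n ^ 4 * p * N)%:R / 2 ^+ Q); last first.
  by rewrite !natrM natrX; ring.
by rewrite ler_pdivrMr ?exprn_gt0 // mul1r -natrX ler_nat.
Qed.

End Cost.

(** * The result of the passes *)

Local Open Scope nat_scope.

Section Position.

Variables (n : nat) (key : 'I_n -> nat).
Hypothesis key_inj : injective key.

Lemma position_subproof v : #|[set u | key u < key v]| < n.
Proof.
rewrite -[ltnRHS]card_ord; apply/proper_card/properP; split.
  by apply/fintype.subsetP.
by exists v; rewrite // inE ltnn.
Qed.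

Definition position v : 'I_n := Ordinal (position_subproof v).

Lemma position_mono u v : (position u < position v) = (key u < key v).
Proof.
apply/idP/idP => [|lt].
  apply: contraTT; rewrite -!leqNgt /= => le; apply/subset_leq_card/fintype.subsetP.
  by move=> x; rewrite !inE => /leq_trans; apply.
apply/proper_card/properP; split.
  by apply/fintype.subsetP => x; rewrite !inE => /ltn_trans; apply.
by exists u; rewrite inE // ltnn.
Qed.

Lemma position_inj : injective position.
Proof.
move=> u v e; apply: key_inj; have := position_mono u v; have := position_mono v u.
by rewrite e ltnn; lia.
Qed.

Definition key_order : 'S_n := perm position_inj.

Lemma back_edges_key_order (E : rel 'I_n) :
  #|back_edges E key_order| = decided_back E key.
Proof. by apply: eq_card => e; rewrite !inE !permE position_mono. Qed.

End Position.

(** * Passes with bounded storage, and the final ordering *)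

Section Passes.

Variables (n : nat) (E : rel 'I_n) (es : seq ('I_n * 'I_n)) (p b m : nat).
Hypotheses (tE : tournament E) (sE : edge_stream E es).

Local Notation total := (total_samples p b m).

(** In use, [marked] holds all samples drawn so far, not only those of the current pass; thus marks
    are never erased. *)
Definition kept (c : 'I_n -> nat) (marked : seq nat) (e : 'I_n * 'I_n) : bool :=
  (c e.1 == c e.2) && ((val e.1 \in marked) || (val e.2 \in marked)).

(** Pass [i] has at most [p * pass_samples i] marked vertices in cells of size about
    [2 ^ b / m ^ i]; the powers of [m] combine to [m ^ p.+1]. *)
Definition capacity : nat := 64 * p * ((p + 5) * b) * m ^ p.+1.

Definition overflow c marked : bool := capacity < count (kept c marked) es.

(** The overflow flag is permanent and freezes the cells, since an incomplete store cannot support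
    exact pivots. *)
Fixpoint pass_state (xs : seq nat) (j : nat) : bool * ('I_n -> nat) :=
  if j is i.+1 then
    let: (f, c) := pass_state xs i in
    let f' := f || overflow c (take (total i.+1) xs) in
    (f', if f' then c
         else foldl (pivot_at E) c (take (pass_samples p b m i) (drop (total i) xs)))
  else (false, fun=> 0).

Definition indegree v : nat := #|[set u | E u v]|.

(* Lexicographic: cell, indegree, name of the vertex; after an overflow [f] the
   cells are ignored. The program computes [p * indegree], as it counts the
   edges again in every pass. *)
Definition final_key (f : bool) (c : 'I_n -> nat) (v : 'I_n) : nat :=
  ((~~ f) * c v * (p * n).+1 + p * indegree v) * n + v.

Lemma count_stream (P : pred ('I_n * 'I_n)) :
  count P es = #|[set e | E e.1 e.2 && P e]|.
Proof.
rewrite (seq.permP sE) -size_filter cardE; apply/perm_size/uniq_perm.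
- by rewrite filter_uniq ?enum_uniq.
- exact: enum_uniq.
- by move=> e; rewrite mem_filter !mem_enum !inE andbC.
Qed.

(** Each kept edge is charged to a marked end, which has [before + after < k] edges inside its
    cell. *)
Lemma count_kept_le c marked k :
  (forall v, #|cell c v| <= k) -> count (kept c marked) es <= size marked * k.
Proof.
move=> ck; set M := [set w : 'I_n | val w \in marked].
have Ms : #|M| <= size marked.
  rewrite cardE -(size_map val); apply: uniq_leq_size.
    by rewrite map_inj_uniq ?enum_uniq //; exact: val_inj.
  by move=> x /mapP[w]; rewrite mem_enum inE => wm ->.
apply: leq_trans (_ : \sum_(w in M) (before E c w + after E c w) <= _).
  rewrite count_stream card_sum_bool.
  rewrite -(pair_bigA _ (fun u v => nat_of_bool (E u v && kept c marked (u, v)))) /=.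
  apply: leq_trans (_ : \sum_u \sum_v ((u \in M) * (E u v && (c u == c v)) +
     (v \in M) * (E u v && (c u == c v))) <= _).
    apply: leq_sum => u _; apply: leq_sum => v _; rewrite /kept /= !inE.
    by case: (E u v); case: (c u == c v); case: (_ \in _); case: (_ \in _).
  under eq_bigr do rewrite big_split /=.
  rewrite big_split /= [X in _ + X <= _]exchange_big [X in _ <= X]big_mkcond -big_split.
  apply: leq_sum => w _ /=; rewrite -!big_distrr /=.
  case: (w \in M); rewrite ?mul0n ?mul1n // addnC /before /after.
  rewrite !card_sum_bool; apply: leq_add; apply: leq_sum => u _.
    by rewrite andbC.
  by rewrite andbC eq_sym.
apply: leq_trans (_ : \sum_(w in M) k <= _).
  by apply: leq_sum => w _; have := ck w; rewrite (card_cell_pivot tE); lia.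
by rewrite sum_nat_const leq_mul2r Ms orbT.
Qed.

Lemma total_samplesS i : total i.+1 = total i + pass_samples p b m i.
Proof. by rewrite /total_samples big_ord_recr. Qed.

Lemma total_samples_le i j : i <= j -> total i <= total j.
Proof.
by move=> /subnKC <-; elim: (j - i) => [|d IH]; rewrite ?addn0 // addnS total_samplesS; lia.
Qed.

Lemma pass_state_spaced xs j : spaced (pass_state xs j).2.
Proof.
elim: j => [|j] /=; first exact: spaced0.
by case: pass_state => f c /= sp; case: ifP => // _; apply: pivots_spaced.
Qed.

Lemma final_key_inj f c : injective (final_key f c).
Proof.
move=> u v; rewrite /final_key => /(congr1 (modn^~ n)).
by rewrite !modnMDl !modn_small ?ltn_ord // => /ord_inj.
Qed.

Hypothesis p0 : 0 < p.

Section Transitive.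

Variable s : 'S_n.
Hypothesis s0 : #|back_edges E s| = 0.

Lemma transitive_edge u v : E u v -> s u < s v.
Proof.
move=> uv; rewrite ltnNge leq_eqVlt; apply/negP => /orP[/eqP/ord_inj/perm_inj e|lt].
  by rewrite e (edge_irr tE) in uv.
by have := card0_eq s0 (u, v); rewrite !inE /= uv lt.
Qed.

Lemma indegree_mono u v : E u v -> indegree u < indegree v.
Proof.
move=> uv; apply/proper_card/properP; split.
  apply/fintype.subsetP => x; rewrite !inE => xu.
  have := transitive_edge xu; have := transitive_edge uv => uv' xu'.
  have [e|//|/transitive_edge] := edgeP tE x v; last by lia.
  by rewrite e in xu'; lia.
by exists u; rewrite inE // (edge_irr tE).
Qed.

(** When no edge goes back in [s], the drift inequality bounds a sum of naturals over all pivots by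
    0, so it holds for each pivot and not only on average. *)
Lemma pivot_at_consistent c x : spaced c ->
  decided_back E c = 0 -> decided_back E (pivot_at E c x) = 0.
Proof.
move=> sp dc; rewrite /pivot_at; case: insub => //= w.
have := sum_pivot_cost tE s sp; rewrite dc.
have -> : undecided_back E s c = 0.
  apply/eqP; rewrite -leqn0 -s0; apply/subset_leq_card/fintype.subsetP => e.
  by rewrite !inE => /andP[].
rewrite !(muln0, addn0) leqn0 sum_nat_eq0 => /forallP/(_ w)/=; lia.
Qed.

Lemma pivots_consistent c xs : spaced c ->
  decided_back E c = 0 -> decided_back E (foldl (pivot_at E) c xs) = 0.
Proof.
elim: xs c => //= x xs IH c sp dc; apply: IH; first exact: pivot_at_spaced.
exact: pivot_at_consistent.
Qed.

(** Along an edge the cell label does not decrease and the indegree increases, so the keys are in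
    order whether or not an overflow occurred. *)
Lemma back_edges_transitive xs j :
  let: (f, c) := pass_state xs j in
  #|back_edges E (key_order (@final_key_inj f c))| = 0.
Proof.
have : decided_back E (pass_state xs j).2 = 0.
  elim: j => [|j]; first by apply: eq_card0 => e; rewrite !inE ltnn andbF.
  have := pass_state_spaced xs j; rewrite /=.
  case: pass_state => f c /= sp dc; case: ifP => // _.
  exact: pivots_consistent.
case: pass_state => f c /= dc.
rewrite back_edges_key_order; apply: eq_card0 => -[u v]; rewrite !inE /=.
apply/negP => /andP[uv]; apply/negP; rewrite -leqNgt.
have cuv : c u <= c v.
  by rewrite leqNgt; apply/negP => lt; have := card0_eq dc (u, v); rewrite !inE /= uv lt.
have := indegree_mono uv; have := ltn_ord u; rewrite /final_key => un lt.
have : (~~ f) * c u * (p * n).+1 <= (~~ f) * c v * (p * n).+1.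
  by rewrite leq_mul2r leq_mul2l cuv !orbT.
have : p * indegree u < p * indegree v by rewrite ltn_pmul2l.
move: (_ * _.+1) (_ * _.+1) (p * _) (p * _) => x y z t zt xy.
have : y + t + 1 <= x + z by lia.
by move: (y + t) (x + z) => a a' aa; nia.
Qed.

End Transitive.

Hypotheses (m0 : 0 < m) (nm : n <= m ^ p) (Nm : 2 ^ b < 2 * m ^ p).

Lemma total_samples_pass i : total i.+1 <= i.+1 * pass_samples p b m i.
Proof.
apply: leq_trans (_ : \sum_(j < i.+1) pass_samples p b m i <= _); last first.
  by rewrite sum_nat_const card_ord.
apply: leq_sum => j _; rewrite /pass_samples leq_mul2l leq_pexp2l ?orbT //.
Qed.

Lemma pass_state_balanced xs j :
  size xs = total p -> balanced E p b m xs -> j <= p ->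
  pass_state xs j = (false, pivots E (take (total j) xs)).
Proof.
move=> sx bal; elim: j => [|j IH] jp.
  by rewrite /= /total_samples big_ord0 take0.
rewrite /= IH ?(ltnW jp) //=.
have -> : overflow (pivots E (take (total j) xs)) (take (total j.+1) xs) = false.
  apply/negbTE; rewrite /overflow -leqNgt.
  (* Pass [j] starts from the cells left by the previous pass; initially there is a single cell of
     [n] vertices. *)
  pose B := if j is 0 then n else cell_bound b m j.
  apply: leq_trans (count_kept_le (k := B) _ _) _.
    move=> v; rewrite /B; case: j {IH B} jp => [|j] jp.
      by rewrite -[leqRHS]card_ord max_card.
    by have /forallP/(_ (Ordinal (ltnW jp)))/forallP := bal; apply.
  rewrite size_takel; last by rewrite sx total_samples_le.
  apply: leq_trans (_ : p * pass_samples p b m j * B <= _).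
    rewrite leq_mul2r; apply/orP; right.
    by apply: leq_trans (total_samples_pass j) _; rewrite leq_mul2r jp orbT.
  (* For [j > 0], [m ^ j * cell_bound j <= 2 ^ b / 2 + m ^ j <= 2 * m ^ p]; for [j = 0],
     [n <= m ^ p] suffices. *)
  have mB : m ^ j.+1 * B <= 2 * m ^ p.+1.
    rewrite /B; case: j jp {IH B} => [|j] jp.
      by rewrite expn1 expnS mulnCA leq_mul2l; lia.
    rewrite (expnS m j.+1) (expnS m p) -mulnA (mulnCA 2) leq_mul2l; apply/orP; right.
    have := leq_trunc_div (2 ^ b) (2 * m ^ j.+1).
    have : m ^ j.+1 <= m ^ p by rewrite leq_pexp2l // ltnW.
    rewrite /cell_bound; move: (2 ^ b %/ (2 * m ^ j.+1)) (m ^ j.+1) (m ^ p) Nm => x y z; nia.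
  rewrite /pass_samples /capacity; move: mB; set X := m ^ j.+1; set Y := m ^ p.+1.
  set Q := (p + 5) * b; move=> mB.
  have : p * Q * (X * B) <= p * Q * (2 * Y) by rewrite leq_mul2l mB orbT.
  by lia.
by rewrite total_samplesS takeD /pivots foldl_cat.
Qed.

Lemma indegree_le v : indegree v <= n.
Proof. by rewrite -[leqRHS]card_ord max_card. Qed.

Lemma final_key_mono c u v : c u < c v -> final_key false c u < final_key false c v.
Proof.
move=> lt; rewrite /final_key !mul1n.
have := indegree_le u; have := ltn_ord u; have := ltn_ord v.
have : c u * (p * n).+1 + (p * n).+1 <= c v * (p * n).+1 by nia.
move: (indegree u) (indegree v) (c u * _) (c v * _) => du dv a a' H vn un dun.
have : a + p * du + 1 <= a' + p * dv by nia.
move: (_ + p * du) (_ + p * dv) => x y; nia.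
Qed.

Lemma back_edges_balanced xs :
  size xs = total p -> let: (f, c) := pass_state xs p in
  #|back_edges E (key_order (@final_key_inj f c))| <= cost_bound E p b m xs.
Proof.
move=> sx; rewrite /cost_bound; case: ifP => [bal|_]; last first.
  case: pass_state => f c; apply: leq_trans (max_card _) _.
  by rewrite card_prod card_ord.
rewrite pass_state_balanced // -sx take_size back_edges_key_order.
(* The last size bound is 1, so every cell is a singleton and the indegrees never decide. *)
have inj : injective (pivots E xs).
  move=> u v e; case: p p0 Nm bal sx => // q _ Nq /forallP/(_ ord_max)/forallP/(_ u).
  rewrite /= => + sx; rewrite -sx take_size /cell_bound divn_small // => /card_le1P.
  by move=> /(_ u); rewrite !inE eqxx => /(_ isT)/(_ v); rewrite !inE e eqxx => /esym/eqP.
apply/subset_leq_card/fintype.subsetP => -[u v]; rewrite !inE /= => /andP[uv lt].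
rewrite uv /=; case: (ltngtP (pivots E xs v) (pivots E xs u)) => //.
  by move/final_key_mono; lia.
by move=> /inj e; rewrite e ltnn in lt.
Qed.

End Passes.

(** * The program *)

Local Notation "e1 +e e2" := (Op Defs.Add e1 e2) (at level 50, left associativity).
Local Notation "e1 *e e2" := (Op Defs.Mul e1 e2) (at level 40, left associativity).
Local Notation "e1 <e e2" := (Op Defs.Lt e1 e2) (at level 70).
Local Notation "e1 =e e2" := (Op Defs.Eq e1 e2) (at level 70).

Fixpoint power (e : aexp) (k : nat) : aexp :=
  if k is k'.+1 then e *e power e k' else Cst 1.

Lemma aeval_power g e k : aeval g (power e k) = aeval g e ^ k.
Proof. by elim: k => //= k ->; rewrite expnS. Qed.

Section Program.

Variable p : nat.

(* Scalar variables: 0: n, 1: b, 2: 2 ^ b, 3: m, 4: the number of samples of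
   the pass, 5: the index of the pass, 8: the overflow flag, 9: the number of
   stored edges; the others are temporary. *)
Definition prepare : cmd :=
  Seq (SetVar 1 (Cst 1)) (Seq (SetVar 2 (Cst 2)) (Seq (SetVar 3 (Cst 1))
  (Seq (For 6 (Var 0) (Seq (SetVar 1 (Var 1 +e (Var 2 <e Var 0)))
                           (SetVar 2 (Var 2 *e (Cst 1 +e (Var 2 <e Var 0))))))
  (Seq (For 6 (Var 0) (SetVar 3 (Var 3 +e (power (Var 3) p <e Var 0))))
       (SetVar 4 (Cst 32 *e (Cst (p + 5) *e Var 1) *e Var 3)))))).

Definition draw : cmd :=
  For 6 (Var 4)
    (Seq (SetVar 15 (Cst 0))
    (Seq (For 7 (Var 1) (Seq (Flip (addr Sc (Cst 10)))
                             (SetVar 15 (Cst 2 *e Var 15 +e Var 10))))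
    (Seq (Set_ Xx (Var 6) (Var 15)) (Set_ Mk (Var 15) (Cst 1))))).

Definition capacity_exp : aexp :=
  Cst (64 * p) *e (Cst (p + 5) *e Var 1) *e power (Var 3) p.+1.

(** [n * n] iterations exhaust the stream; reads past its end change nothing that matters. An edge
    is read into the next free slot and stays there only if the counter advances, so a full store
    needs one scratch slot. *)
Definition collect : cmd :=
  Seq (SetVar 9 (Cst 0)) (Seq NewPass
  (For 6 (Var 0 *e Var 0)
    (Seq (Read (addr Fl (Var 9)))
    (If (compile (At Fl (Var 9)))
      (Seq (Set_ Dd (At Hd (Var 9)) (At Dd (At Hd (Var 9)) +e Cst 1))
      (If (compile ((At Cc (At Tl (Var 9)) =e At Cc (At Hd (Var 9)))
                 *e (Cst 0 <e At Mk (At Tl (Var 9)) +e At Mk (At Hd (Var 9)))))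
        (If (compile (Var 9 <e capacity_exp))
          (SetVar 9 (Var 9 +e Cst 1)) (SetVar 8 (Cst 1)))
        Skip))
      Skip)))).

(** For each sampled vertex, one sweep over the stored edges counts its in-neighbours in its cell
    and a second moves its out-neighbours. Labels are tested again, because the edges were selected
    by the cells at the start of the pass. *)
Definition refine : cmd :=
  For 6 (Var 4)
    (Seq (SetVar 10 (At Xx (Var 6)))
    (If (compile ((Var 10 <e Var 0) *e (Var 8 =e Cst 0)))
      (Seq (SetVar 11 (At Cc (Var 10))) (Seq (SetVar 12 (Cst 0))
      (Seq (For 13 (Var 9) (SetVar 12 (Var 12 +e
             (At Hd (Var 13) =e Var 10) *e (At Cc (At Tl (Var 13)) =e Var 11))))
      (Seq (For 13 (Var 9) (Set_ Cc (At Hd (Var 13)) (At Cc (At Hd (Var 13)) +e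
             (At Tl (Var 13) =e Var 10) *e (At Cc (At Hd (Var 13)) =e Var 11)
               *e (Var 12 +e Cst 1))))
           (Set_ Cc (Var 10) (Var 11 +e Var 12))))))
      Skip)).

Definition key_exp (v : aexp) : aexp :=
  ((Var 8 =e Cst 0) *e At Cc v *e (Cst p *e Var 0 +e Cst 1) +e At Dd v) *e Var 0 +e v.

(** Position [i] goes to the vertex with exactly [i] smaller keys. Ranks are recomputed each time,
    which costs cubic time but no further array. *)
Definition print : cmd :=
  For 5 (Var 0) (For 6 (Var 0)
    (Seq (SetVar 14 (Cst 0))
    (Seq (For 7 (Var 0)
           (SetVar 14 (Var 14 +e (key_exp (Var 7) <e key_exp (Var 6)))))
         (If (compile (Var 14 =e Var 5)) (Emit (compile (Var 6))) Skip)))).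

Definition program : cmd :=
  Seq prepare (Seq
    (For 5 (Cst p) (Seq draw (Seq collect (Seq refine
                      (SetVar 4 (Var 4 *e Var 3))))))
    print).

End Program.

(** The linear search done by the loops of [prepare]: it moves up from 1 as long as [P] holds. It
    yields the least suitable positive [b] and [m]. *)
Definition climb (P : pred nat) (k : nat) : nat := iter k (fun x => x + P x) 1.

Lemma climb_mono P j k : j <= k -> climb P j <= climb P k.
Proof.
move=> /subnKC <-; elim: (k - j) => [|d IH]; first by rewrite addn0.
by apply: leq_trans IH _; rewrite addnS /climb iterS leq_addr.
Qed.

Lemma climb_gt0 P k : 0 < climb P k.
Proof. exact: (climb_mono P (leq0n k)). Qed.

Lemma climb_pred P k : climb P k = 1 \/ P (climb P k).-1.
Proof.
elim: k => [|k IH]; first by left.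
rewrite /climb iterS -/(climb P k); case e: (P (climb P k)); last by rewrite addn0.
by right; rewrite addn1.
Qed.

(** As long as [P] holds, every step adds one, so after [k] steps the value would exceed [k]. *)
Lemma climb_stop (P : pred nat) k : (forall x, P x -> x <= k) -> P (climb P k) = false.
Proof.
move=> Pk; apply/negP => Pc; have {Pk} := Pk _ Pc.
suff H j : P (climb P j) -> j < climb P j by have := H k Pc; lia.
elim: j => [//|j IH]; rewrite /climb iterS -/(climb P j).
by case e: (P (climb P j)); rewrite ?addn0 ?e // addn1 => _; have := IH e; lia.
Qed.

Lemma bits_value_lt a l : bits_value a l < a.+1 * 2 ^ size l.
Proof.
elim: l a => [|x l IH] a /=; first by rewrite muln1.
by apply: leq_trans (IH _) _; rewrite expnS mulnA leq_mul2r; case: x; lia.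
Qed.

Lemma sample_lt b r k : sample b r k < 2 ^ b.
Proof.
apply: leq_trans (bits_value_lt _ _) _; rewrite mul1n leq_exp2l // size_take.
by case: ifP; lia.
Qed.

Lemma samples_drop b r s k t : s + k <= t ->
  samples b (drop (s * b) r) k = take k (drop s (samples b r t)).
Proof.
move=> skt; have sz : size (drop s (samples b r t)) = t - s by rewrite size_drop size_mkseq.
apply: (@eq_from_nth _ 0); first by rewrite size_mkseq size_takel // sz; lia.
rewrite size_mkseq => i ik; rewrite nth_take // nth_drop !nth_mkseq //; last by lia.
by rewrite /sample drop_drop mulnDl addnC.
Qed.

(** * Correctness of the program *)

Section Correctness.

Local Arguments compile : simpl never.
Local Arguments take : simpl never.
Local Arguments drop : simpl never.

Variables (p n b m W B : nat) (E : rel 'I_n) (es : seq ('I_n * 'I_n)).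
Hypotheses (tE : tournament E) (sE : edge_stream E es).
Hypotheses (W16 : 16 <= W) (nW : n <= W) (bW : 2 ^ b <= W).
Hypotheses (capW : capacity p b m <= W).
Hypotheses (WB : W.*2 <= B) (nnB : n * n <= B) (pnB : p * n <= B).

Local Notation stream := [seq (val e.1, val e.2) | e <- es].
Local Notation wp := (wp W B stream).

Lemma ord_le_B (v : 'I_n) : v <= B.
Proof. by have := ltn_ord v; lia. Qed.

(** What survives from one command to the next; samples and stored edges are described separately.
    Marks are specified at all indices, because a sample may be [n] or more, labels and counters
    only at vertices. *)
Record inv (i K : nat) (f : bool) (mk : seq nat) (c d : 'I_n -> nat) (ps : nat)
    (cs : seq bool) (out : seq nat) (a : astate) : Prop := Inv {
  inv_n : amem a Sc 0 = n;
  inv_b : amem a Sc 1 = b;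
  inv_N : amem a Sc 2 = 2 ^ b;
  inv_m : amem a Sc 3 = m;
  inv_K : amem a Sc 4 = K;
  inv_i : amem a Sc 5 = i;
  inv_f : amem a Sc 8 = f;
  inv_mk : forall x, amem a Mk x = (x \in mk);
  inv_c : forall v : 'I_n, amem a Cc v = c v;
  inv_d : forall v : 'I_n, amem a Dd v = d v;
  inv_passes : apasses a = ps;
  inv_coins : acoins a = cs;
  inv_output : aoutput a = out
}.

Definition temporary (r : arr) (i : nat) : bool :=
  match r with
  | Sc => (i == 6) || (i == 7) || (8 < i)
  | Xx | Fl | Tl | Hd => true
  | _ => false
  end.

Lemma inv_temporary i K f mk c d ps cs out a r j x :
  temporary r j -> inv i K f mk c d ps cs out a ->
  inv i K f mk c d ps cs out (aset a r j x).
Proof. by case: r => // t [] *; split=> //=; case: eqP => // e; subst j. Qed.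

Lemma inv_io i K f mk c d ps cs out ps' cs' out' a a' :
  inv i K f mk c d ps cs out a -> amem a' = amem a ->
  apasses a' = ps' -> acoins a' = cs' -> aoutput a' = out' ->
  inv i K f mk c d ps' cs' out' a'.
Proof. by case=> *; split=> //; congruence. Qed.

Lemma inv_ext i K f mk c d ps cs out f' mk' c' d' a :
  inv i K f mk c d ps cs out a ->
  f = f' -> mk =i mk' -> c =1 c' -> d =1 d' ->
  inv i K f' mk' c' d' ps cs out a.
Proof.
case=> ? ? ? ? ? ? ? hm hc hd ? ? ? <- em ec ed; split=> // v.
- by rewrite hm em.
- by rewrite hc ec.
- by rewrite hd ed.
Qed.

Section Draw.

Variables (i K : nat) (f : bool) (mk : seq nat) (c d : 'I_n -> nat) (ps : nat).
Variables (cs : seq bool) (out : seq nat).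
Hypotheses (KW : K <= W) (Kcs : K * b <= size cs).

Lemma wp_draw a :
  inv i K f mk c d ps cs out a ->
  wp draw (fun a' => inv i K f (mk ++ samples b cs K) c d ps (drop (K * b) cs) out a'
     /\ forall j, j < K -> amem a' Xx j = nth 0 (samples b cs K) j) a.
Proof.
move=> ia.
apply: (wp_for (N := K) (I := fun j a =>
  inv i K f (mk ++ samples b cs j) c d ps (drop (j * b) cs) out a /\
  forall k, k < j -> amem a Xx k = nth 0 (samples b cs j) k)) => //=; try lia.
- by split=> //; rewrite cats0 mul0n drop0; apply: inv_temporary.
- by move=> j a' _ _ [/inv_K].
move=> j {}a jK a6 [{}ia xa].
apply: wp_seq; apply: wp_set => //=; first by lia.
apply: wp_seq.
apply: (wp_for (N := b) (I := fun t a =>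
  [/\ amem a Sc 6 = j, inv i K f (mk ++ samples b cs j) c d ps (drop (j * b + t) cs) out a,
  forall k, k < j -> amem a Xx k = nth 0 (samples b cs j) k &
  amem a Sc 15 = bits_value 0 (take t (drop (j * b) cs))])) => //=; try lia.
- by have := ltn_expl b (ltnSn 1); lia.
- by rewrite addn0 take0; split=> //; do 2 apply: inv_temporary => //.
- by move=> t a' _ _ [_ /inv_b].
- move=> t {}a tb a7 [{}a6 {}ia {}xa a15].
  apply: wp_seq; apply: wp_flip => /=; [lia|lia|].
  have tj : j * b + t < size cs.
    by apply: leq_trans Kcs; apply: leq_trans (_ : j.+1 * b <= _); [lia|rewrite leq_mul2r jK orbT].
  have tk : take t.+1 (drop (j * b) cs) =
      rcons (take t (drop (j * b) cs)) (nth false cs (j * b + t)).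
    by rewrite (take_nth false) ?size_drop ?nth_drop //; lia.
  apply: wp_set => /=; [by lia| |]; rewrite ?a15 (inv_coins ia) -nth0 nth_drop addn0.
  - have := bits_value_lt 0 (take t.+1 (drop (j * b) cs)).
    rewrite tk /bits_value foldl_rcons -/(bits_value _ _) mul1n => lt.
    apply: leq_trans (ltnW lt) _; apply: leq_trans (_ : 2 ^ b <= _); last by lia.
    by rewrite leq_exp2l // -tk size_take; case: ifP; lia.
  - split=> //; split=> //.
      apply: inv_temporary => //; apply: inv_temporary => //.
      rewrite -drop1 drop_drop add1n addnS -/(aset (AState _ _ _ _ _) Sc 10 _).
      apply: (@inv_temporary _ _ _ _ _ _ _ _ _ (AState _ _ _ _ _)) => //.
      by apply: (inv_io ia) => //=; [apply: inv_passes ia|apply: inv_output ia].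
    by rewrite tk /bits_value foldl_rcons.
move=> {}a a7 [{}a6 {}ia {}xa a15].
have eb : bits_value 0 (take b (drop (j * b) cs)) = sample b cs j by [].
rewrite eb in a15.
have sl := sample_lt b cs j.
apply: wp_seq; apply: wp_set => //=; rewrite ?a6 ?a15; [lia|lia|].
apply: wp_set => //=; rewrite ?a6 ?a15; [lia|lia|].
split=> //; split; last first.
  move=> k kj; rewrite nth_mkseq //.
  have [-> //|ne] := eqVneq k j; have kj' : k < j by lia.
  by rewrite xa // nth_mkseq.
apply: inv_temporary => //; rewrite mulSn [b + _]addnC.
case: ia => *; split=> //= x; rewrite /samples -/(samples b cs j) mkseqS.
rewrite mem_cat mem_rcons inE orbCA -mem_cat.
by have [_|_] := eqVneq x (sample b cs j).
Qed.

End Draw.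

Section Collect.

Variables (i K : nat) (f : bool) (mk : seq nat) (c d : 'I_n -> nat) (ps : nat).
Variables (cs : seq bool) (out : seq nat).
Hypotheses (dB : forall v, d v + indegree E v <= B).

Local Notation P := (kept c mk).
Local Notation cap := (capacity p b m).
Local Notation ends := (fun e : 'I_n * 'I_n => (val e.1, val e.2)).

(** The counter saturates at the capacity, so only an initial part of the kept edges is
    guaranteed. *)
Definition stored (l : seq ('I_n * 'I_n)) (a : astate) : Prop :=
  let s := [seq e <- l | kept c mk e] in
  amem a Sc 9 = minn cap (size s) /\
  forall k, k < minn cap (size s) ->
    (amem a Tl k, amem a Hd k) = nth (0, 0) (map ends s) k.

Lemma count_indegree w : count (fun e => e.2 == w) es = indegree E w.
Proof.
rewrite (count_stream sE) /indegree.
rewrite -(card_imset (mem [set u | E u w]) (f := fun u => (u, w))); last by move=> x y [].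
apply: eq_card => -[u v]; rewrite !inE /=; apply/andP/imsetP => [[uv /eqP <-]|].
  by exists u; rewrite ?inE.
by move=> [x]; rewrite inE => xw [-> ->].
Qed.

Lemma wp_collect a :
  inv i K f mk c d ps cs out a ->
  wp (collect p) (fun a' =>
    inv i K (f || overflow es p b m c mk) mk c (fun v => d v + indegree E v)
      ps.+1 cs out a' /\ stored es a' /\ forall k, amem a' Xx k = amem a Xx k) a.
Proof.
move eX: (amem a Xx) => X ia; apply: wp_seq; apply: wp_set => //=; first by lia.
apply: wp_seq; apply: wp_newpass.
have sz : size es <= n * n.
  rewrite (perm_size sE) -cardE; apply: leq_trans (max_card _) _.
  by rewrite card_prod card_ord.
apply: (wp_for (N := n * n) (I := fun j a =>
  [/\ inv i K (f || (cap < count P (take j es))) mk c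
        (fun v => d v + count (fun e => e.2 == v) (take j es)) ps.+1 cs out a,
      stored (take j es) a, arest a = drop j stream
    & forall k, amem a Xx k = X k])) => //=; first by lia.
- split; [| |by rewrite drop0|by move=> k /=; rewrite eX].
    apply: inv_temporary => //; rewrite take0 /= ltn0 orbF.
    apply: inv_ext (_ : inv i K f mk c d ps.+1 cs out _) _ _ _ _ => //; last first.
      by move=> v /=; rewrite addn0.
    apply: (inv_io (inv_temporary (r := Sc) (j := 9) 0 isT ia)) => //=.
    - by rewrite (inv_passes ia).
    - exact: inv_coins ia.
    - exact: inv_output ia.
  by rewrite /stored take0.
- by move=> j a' _ _ [ia' _ _ _] /=; rewrite (inv_n ia').
- move=> j {ia eX}a jn a6 [ia [a9 st] ar aX].
  have tk : take j.+1 es = take j es ++ take 1 (drop j es) by rewrite -addn1 takeD.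
  have dk : drop j.+1 stream = behead (drop j stream) by rewrite -drop1 drop_drop add1n.
  have len : amem a Sc 9 <= cap by rewrite a9 geq_minl.
  apply: wp_seq; apply: wp_read => /=; [lia|lia| |].
    rewrite ar -map_drop all_map; by apply/allP => e _ /=; rewrite !ord_le_B.
  rewrite tk dk ar -map_drop; case de: (drop j es) => [|[u v] l] /=.
    apply: wp_if => /=; rewrite eqxx //= => _; apply: wp_skip; split=> //.
    rewrite cats0; split=> //.
      by do 2 apply: inv_temporary => //.
    by rewrite /= ar -map_drop de.
  have t1 : take 1 ((u, v) :: l) = [:: (u, v)] by rewrite -cat1s take_size_cat.
  rewrite t1; set a1 := AState _ _ _ _ _.
  have ia1 : inv i K (f || (cap < count P (take j es))) mk c
    (fun v => d v + count (fun e => e.2 == v) (take j es)) ps.+1 cs out a1.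
    do 3 apply: (@inv_temporary _ _ _ _ _ _ _ _ _ (AState _ _ _ _ _)) => //.
    by apply: (inv_io ia) => //=; [apply: inv_passes ia|apply: inv_coins ia|apply: inv_output ia].
  have dv w : count (fun e => e.2 == w) (take j es ++ [:: (u, v)]) <= indegree E w.
    by rewrite -t1 -de -tk -count_indegree -[in leqRHS](cat_take_drop j.+1 es) count_cat leq_addr.
  apply: wp_if => /=; rewrite eqxx //= => _; apply: wp_seq; apply: wp_set => /=.
  - have := ltn_ord v; rewrite !eqxx /=; lia.
  - rewrite !eqxx /= (inv_d ia); apply: leq_trans (dB v).
    by have := dv v; rewrite count_cat /= eqxx; lia.
  set a2 := aset a1 _ _ _.
  have ia2 : inv i K (f || (cap < count P (take j es))) mk c
    (fun w => d w + count (fun e => e.2 == w) (take j es ++ [:: (u, v)])) ps.+1 cs out a2.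
    case: ia1 => /= *; split=> //= w; rewrite !eqxx /= count_cat /= addn0 eq_sym.
    rewrite val_eqE; have [->|_] := eqVneq v w; last by rewrite addn0 (inv_d ia).
    by rewrite (inv_d ia) addnA.
  have tag : aeval (amem a2) ((At Cc (At Tl (Var 9)) =e At Cc (At Hd (Var 9))) *e
      (Cst 0 <e At Mk (At Tl (Var 9)) +e At Mk (At Hd (Var 9)))) = kept c mk (u, v).
    rewrite /= !eqxx /= !(inv_c ia) !(inv_mk ia) /kept /= -mulnb; congr (_ * _).
    by case: (_ \in _); case: (_ \in _).
  have a2_9 : amem a2 Sc 9 = amem a Sc 9 by [].
  have full : aeval (amem a2) (Var 9 <e capacity_exp p) = (amem a Sc 9 < cap).
    by rewrite /= aeval_power /= (inv_b ia) (inv_m ia) -expnS /capacity !mulnA.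
  have szP l' : count P l' = size [seq e <- l' | P e] by rewrite size_filter.
  have mapP : [seq ends e | e <- take j es ++ [:: (u, v)] & P e] =
     [seq ends e | e <- take j es & P e] ++ [seq ends e | e <- [:: (u, v)] & P e].
    by rewrite filter_cat map_cat.
  apply: wp_if; rewrite tag.
    rewrite eqb0 negbK => kuv; move: mapP; rewrite /= kuv /= => mapP.
    apply: wp_if; rewrite full.
      rewrite eqb0 negbK => lt; apply: wp_set; [by rewrite /=; lia|by rewrite /=; lia|].
      split=> //; split=> //.
        do 2 apply: inv_temporary => //; apply: (inv_ext ia2) => //; congr (_ || _).
        by rewrite count_cat /= kuv szP; lia.
      have sz1 : size [seq e <- take j es ++ [:: (u, v)] | P e] =
          (size [seq e <- take j es | P e]).+1.
        by rewrite -!szP count_cat /= kuv addn1.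
      have lt' : size [seq e <- take j es | P e] < cap by lia.
      rewrite /stored sz1 mapP; split=> [|k kl]; first by rewrite /= a9; lia.
      rewrite nth_cat size_map; have [ks|sk] := ltnP.
        have ne : k != amem a Sc 9 by lia.
        by rewrite /= (negbTE ne) st //; lia.
      have -> : k = size [seq e <- take j es | P e] by lia.
      have -> : size [seq e <- take j es | P e] = amem a Sc 9 by lia.
      by rewrite subnn /= eqxx.
    (* The store is full: the edge lies in the scratch slot, beyond the range that [stored]
       describes, and the overflow flag is raised. *)
    move/eqP; rewrite eqb0 -leqNgt => ge; have lc : amem a Sc 9 = cap by lia.
    apply: wp_set => /=; [lia|lia|]; split=> //; split=> //.
      apply: inv_temporary => //.
      have -> : f || (cap < count P (take j es ++ [:: (u, v)])) = true.
        by rewrite count_cat /= kuv szP; lia.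
      by case: ia2 => *; split.
    have sz2 : size [seq e <- take j es ++ [:: (u, v)] | P e] =
        (size [seq e <- take j es | P e]).+1.
      by rewrite -!szP count_cat /= kuv addn1.
    rewrite /stored sz2 mapP; split=> [|k kl]; first by rewrite /= a9; lia.
    have ne : k != amem a Sc 9 by lia.
    rewrite nth_cat size_map; have -> : k < size [seq e <- take j es | P e] by lia.
    by rewrite /= (negbTE ne) st //; lia.
  move/eqP; rewrite eqb0 => /negbTE kuv; apply: wp_skip; split=> //; split=> //.
    apply: inv_temporary => //.
    by move: ia2; rewrite !count_cat /= kuv !addn0.
  rewrite /stored filter_cat /= kuv cats0; split=> //= k kl.
  have [ka|kb] := eqVneq k (amem a Sc 9); first by move: kl; rewrite ka a9 ltnn.
  exact: st.
move=> a' _ [ia' st _ aX]; rewrite take_oversize // in ia' st; split=> //.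
by apply: (inv_ext ia') => // v; rewrite count_indegree.
Qed.

End Collect.

Section Refine.

Variables (i K : nat) (f : bool) (mk : seq nat) (c d : 'I_n -> nat) (ps : nat).
Variables (cs : seq bool) (out : seq nat) (xs : seq nat).
Hypotheses (sp : spaced c) (KW : K <= W) (sxs : size xs = K).
Hypotheses (xmk : {subset xs <= mk}) (xW : forall x, x \in xs -> x <= W).
Hypotheses (fcap : f = false -> overflow es p b m c mk = false).

Local Notation edges := [seq e <- es | kept c mk e].

Lemma foldl_pivot_at_inj c1 ys u v :
  spaced c1 -> foldl (pivot_at E) c1 ys u = foldl (pivot_at E) c1 ys v -> c1 u = c1 v.
Proof.
elim: ys c1 => //= y ys IH c1 sp1 /(IH _ (pivot_at_spaced tE y sp1)).
by rewrite /pivot_at; case: insub => //= w; apply: pivot_inj.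
Qed.

(** [c] selected the edges at the start of the pass and [c1] refines it, so all edges at a marked
    [w] inside its current cell were kept. *)
Lemma mem_edges (c1 : 'I_n -> nat) w v :
  (forall u v, c1 u = c1 v -> c u = c v) -> val w \in mk -> c1 v = c1 w ->
  ((w, v) \in edges) = E w v.
Proof.
move=> ref wm e; rewrite mem_filter (perm_mem sE) mem_enum /kept /= wm andbT.
by rewrite (ref _ _ e) eqxx.
Qed.

Lemma count_before (c1 : 'I_n -> nat) w :
  (forall u v, c1 u = c1 v -> c u = c v) -> val w \in mk ->
  count (fun e => (e.2 == w) && (c1 e.1 == c1 w)) edges = before E c1 w.
Proof.
move=> ref wm; rewrite count_filter (count_stream sE) /before.
rewrite -(card_imset (mem [set u | (c1 u == c1 w) && E u w]) (f := fun u => (u, w)));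
  last by move=> x y [].
apply: eq_card => -[u v]; rewrite !inE /=; apply/andP/imsetP => [[uv]|].
  by case/andP=> /andP[/eqP <- cu] _; exists u; rewrite ?inE ?cu.
move=> [x]; rewrite inE => /andP[cx xw] [-> ->]; split=> //.
by rewrite eqxx cx /kept /= (ref _ _ (eqP cx)) eqxx wm orbT.
Qed.

Lemma wp_refine a :
  inv i K f mk c d ps cs out a -> stored mk c es a ->
  (forall j, j < K -> amem a Xx j = nth 0 xs j) ->
  wp refine
    (inv i K f mk (if f then c else foldl (pivot_at E) c xs) d ps cs out) a.
Proof.
move=> ia sta xa.
apply: (wp_for (N := K) (I := fun j a =>
  [/\ inv i K f mk (if f then c else foldl (pivot_at E) c (take j xs)) d ps cs out a,
      stored mk c es a & forall j, j < K -> amem a Xx j = nth 0 xs j])) => //=; try lia.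
- split=> //; rewrite take0; apply: inv_temporary => //.
  by apply: (inv_ext ia) => // v; case: ifP.
- by move=> j a' _ _ [/inv_K].
- move=> j {ia sta xa}a jK a6 [ia [a9 st] xa].
  have xjW : nth 0 xs j <= W by apply: xW; rewrite mem_nth ?sxs.
  apply: wp_seq; apply: wp_set => /=; [lia|by rewrite a6 xa //; lia|]; rewrite a6 xa //.
  set cj := (if f then _ else _) in ia; set x := nth 0 xs j.
  set a1 := aset _ _ _ _.
  have ia1 : inv i K f mk cj d ps cs out a1 by apply: inv_temporary.
  have tk : take j.+1 xs = rcons (take j xs) x by rewrite (take_nth 0) ?sxs.
  have test : aeval (amem a1) ((Var 10 <e Var 0) *e (Var 8 =e Cst 0)) = (x < n) && ~~ f.
    rewrite /= (inv_n ia) (inv_f ia) eqb0; exact: mulnb.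
  apply: wp_if; rewrite test; last first.
    move/eqP; rewrite eqb0 => no; apply: wp_skip; split=> //; split=> //.
    apply: inv_temporary => //; apply: (inv_ext ia1) => //.
    rewrite /cj tk; case: (f) no => //=; rewrite andbT => xn v.
    by rewrite foldl_rcons /pivot_at insubN.
  rewrite eqb0 negbK => /andP[xn /negbTE f0].
  have xw : val (Ordinal xn) = x by [].
  move: (Ordinal xn) xw => w xw.
  have cjE : cj = foldl (pivot_at E) c (take j xs) by rewrite /cj f0.
  have spj : spaced cj by rewrite cjE; apply: pivots_spaced.
  have ref u v : cj u = cj v -> c u = c v by rewrite cjE; apply: foldl_pivot_at_inj.
  have wm : val w \in mk by rewrite xw; apply: xmk; rewrite mem_nth ?sxs.
  (* Without overflow the minimum in [stored] is the number of kept edges, so the store is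
     complete. *)
  have stE a' : stored mk c es a' -> amem a' Sc 9 = size edges /\
      forall k, k < size edges ->
        amem a' Tl k = (nth (w, w) edges k).1 /\ amem a' Hd k = (nth (w, w) edges k).2.
    have le : size edges <= capacity p b m.
      by move: (fcap f0); rewrite /overflow -(size_filter (fun e => kept c mk e)); lia.
    case=> -> st'; split; first exact/minn_idPr.
    move=> k kl; have := st' k; rewrite (minn_idPr le) (nth_map (w, w)) // => /(_ kl)[-> ->].
    by [].
  have lenW : size edges <= W by have [<- _] := stE a (conj a9 st); rewrite a9; lia.
  have cw := card_cell_pivot tE cj w.
  have cwn := spj.2 w; have cn v : cj v <= n by have := spj.2 v; lia.
  set B0 := before E cj w in cw *.
  have B0n : B0 < #|cell cj w| by lia.
  have a1w : amem a1 Cc x = cj w by rewrite -xw (inv_c ia1).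
  apply: wp_seq; apply: wp_set => /=; [lia|by rewrite -[amem a Cc _]/(amem a1 Cc x) a1w; lia|].
  rewrite -[amem a Cc _]/(amem a1 Cc x) a1w.
  apply: wp_seq; apply: wp_set => /=; [lia|lia|].
  pose Q (e : 'I_n * 'I_n) := (e.2 == w) && (cj e.1 == cj w).
  have cQ : count Q edges = B0 by exact: count_before.
  have cQ' e : count Q (take e edges) <= B0.
    by rewrite -cQ -[in leqRHS](cat_take_drop e edges) count_cat leq_addr.
  apply: wp_seq; apply: (wp_for (N := size edges) (I := fun e a =>
    [/\ inv i K f mk cj d ps cs out a, stored mk c es a,
      forall j, j < K -> amem a Xx j = nth 0 xs j &
      [/\ amem a Sc 6 = j, amem a Sc 10 = x, amem a Sc 11 = cj w &
          amem a Sc 12 = count Q (take e edges)]])) => //=; try lia.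
  - rewrite take0; split=> //; do 3 apply: inv_temporary => //; exact: ia1.
  - by move=> e a' _ _ [_ /stE[]].
  - move=> e {ia a9 st xa a6 a1 ia1 test a1w}a el a13 [ia sta xa [a6 a10 a11 a12]].
    have [_ /(_ e el)[tl hd]] := stE a sta.
    have new : amem a Sc 12 + (amem a Hd e == x) * (amem a Cc (amem a Tl e) == cj w)
        = count Q (take e.+1 edges).
      rewrite (take_nth (w, w)) // -cats1 count_cat /= addn0 a12 hd tl (inv_c ia) -xw.
      by rewrite /Q val_eqE mulnb.
    apply: wp_set => /=; rewrite ?a13 ?a10 ?a11 ?new; [lia|have := cQ' e.+1; lia|].
    split=> //; split=> //; do 2 apply: inv_temporary => //; exact: ia.
  move=> {ia a9 st xa a6 a1 ia1 test a1w}a _ [ia sta xa [a6 a10 a11 a12]].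
  rewrite take_oversize // cQ in a12.
  (* The labels after [e] edges of the second sweep: only the out-neighbours of [w] met so far have
     moved, and [w] itself moves after the sweep. *)
  pose ce e v := if ((w, v) \in take e edges) && (cj v == cj w) then cj w + B0.+1 else cj v.
  apply: wp_seq; apply: (wp_for (N := size edges) (I := fun e a =>
    [/\ inv i K f mk (ce e) d ps cs out a, stored mk c es a,
      forall j, j < K -> amem a Xx j = nth 0 xs j &
      [/\ amem a Sc 6 = j, amem a Sc 10 = x, amem a Sc 11 = cj w &
          amem a Sc 12 = B0]])) => //=; try lia.
  - split=> //; apply: inv_temporary => //; apply: (inv_ext ia) => // v.
    by rewrite /ce take0.
  - by move=> e a' _ _ [_ /stE[]].
  - move=> e {ia sta xa a6 a10 a11 a12}a el a13 [ia sta xa [a6 a10 a11 a12]].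
    have [_ /(_ e el)[tl hd]] := stE a sta.
    move: tl hd; case ee: (nth (w, w) edges e) => [u v] /= tl hd.
    have cen : ce e.+1 v <= n by rewrite /ce; case: ifP => _; [lia|exact: cn].
    have cvn := cn v; have vn := ltn_ord v.
    have new : amem a Cc v + (amem a Tl e == x) * (amem a Cc v == cj w) * (B0 + 1)
        = ce e.+1 v.
      rewrite (inv_c ia) tl -xw val_eqE /ce (take_nth (w, w)) // mem_rcons inE ee xpair_eqE.
      rewrite eqxx andbT [w == u]eq_sym.
      by case: (_ \in take e edges); case: (cj v =P cj w) => [->|/eqP/negbTE ne] /=;
        rewrite ?andbT ?andbF ?orbT ?ne; case: (u == w) => /=; lia.
    apply: wp_set => /=; rewrite a13 hd ?a10 ?a11 ?a12 ?new; [lia|lia|].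
    split=> //; split=> //; apply: inv_temporary => //.
    case: (ia) => *; split=> //= v'; rewrite val_eqE; have [->//|ne] := eqVneq v' v.
    rewrite (inv_c ia) /ce (take_nth (w, w)) // mem_rcons inE ee xpair_eqE.
    by rewrite (negbTE ne) andbF.
  move=> {ia sta xa a6 a10 a11 a12}a _ [ia sta xa [a6 a10 a11 a12]].
  apply: wp_set => /=; rewrite ?a10 ?a11 ?a12; [lia|lia|].
  split=> //; split=> //; apply: inv_temporary => //.
  case: (ia) => *; split=> //= v'; rewrite f0 tk foldl_rcons -cjE -xw val_eqE.
  rewrite /pivot_at valK /= /pivot -/B0.
  have [->|ne] := eqVneq v' w; first by rewrite eqxx.
  rewrite (inv_c ia) /ce take_size; have [e|_] := eqVneq; last by rewrite andbF.
  by rewrite andbT (mem_edges ref wm e) e.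
move=> a' _ [ia' _ _]; rewrite take_oversize // in ia'; lia.
Qed.

End Refine.
Lemma inv_index i K f mk c d ps cs out a j :
  inv i K f mk c d ps cs out a -> inv j K f mk c d ps cs out (aset a Sc 5 j).
Proof. by case=> *; split. Qed.

Section Print.

Variables (K : nat) (f : bool) (mk : seq nat) (c d : 'I_n -> nat) (ps : nat).
Variables (cs : seq bool).
Hypothesis dE : forall v, d v = p * indegree E v.

Local Notation key := (final_key E p f c).
Local Notation order := (key_order (@final_key_inj n E p f c)).

Lemma aeval_key_exp i out a e (v : 'I_n) :
  inv i K f mk c d ps cs out a -> aeval (amem a) e = v ->
  aeval (amem a) (key_exp p e) = key v.
Proof.
move=> ia ev; rewrite /= ev (inv_c ia) (inv_d ia) (inv_n ia) (inv_f ia) eqb0 dE.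
by rewrite /final_key addn1.
Qed.

Lemma count_enum (P : pred 'I_n) : count P (enum 'I_n) = #|[set v | P v]|.
Proof. by rewrite -sum1_count big_enum_cond /= sum1dep_card. Qed.

Lemma take_enumS i (lt : i < n) :
  take i.+1 (enum 'I_n) = rcons (take i (enum 'I_n)) (Ordinal lt).
Proof.
by rewrite (take_nth (Ordinal lt)) ?size_enum_ord // (nth_ord_enum _ (Ordinal lt)).
Qed.

Lemma wp_print i0 a :
  inv i0 K f mk c d ps cs [::] a ->
  wp (print p) (fun a' => apasses a' = ps /\
    aoutput a' = [seq val ((order^-1)%g i) | i <- enum 'I_n]) a.
Proof.
move=> ia.
apply: (wp_for (N := n) (I := fun i a => inv i K f mk c d ps cs
  [seq val ((order^-1)%g x) | x <- take i (enum 'I_n)] a)) => //=; try lia.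
- by rewrite take0; apply: inv_index ia.
- by move=> j a' _ _ /inv_n.
- move=> i {ia}a lti a5 ia; set out := [seq _ | _ <- _] in ia.
  set v0 := (order^-1)%g (Ordinal lti).
  apply: (wp_for (N := n) (I := fun j a => inv i K f mk c d ps cs
     (out ++ if v0 < j then [:: val v0] else [::]) a)) => //=; try lia.
  + by rewrite cats0; apply: inv_temporary.
  + by move=> j a' _ _ /inv_n.
  + move=> j {ia a5}a ltj a6 ia; pose v := Ordinal ltj.
    apply: wp_seq; apply: wp_set => /=; [lia|lia|].
    apply: wp_seq; apply: (wp_for (N := n) (I := fun u a => [/\ amem a Sc 6 = j,
       inv i K f mk c d ps cs (out ++ if v0 < j then [:: val v0] else [::]) a
       & amem a Sc 14 = count (fun x => key x < key v) (take u (enum 'I_n))])) => //=; try lia.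
    * by rewrite take0; split=> //; do 2 apply: inv_temporary => //.
    * by move=> u a' _ _ [_ /inv_n].
    * move=> u {ia a6}a ltu a7 [a6 ia a14].
      have new : aeval (amem a) (Var 14 +e (key_exp p (Var 7) <e key_exp p (Var 6))) =
          count (fun x => key x < key v) (take u.+1 (enum 'I_n)).
        rewrite (take_enumS ltu) -cats1 count_cat /= addn0 -a14; congr (_ + _).
        by rewrite -(aeval_key_exp (e := Var 7) (v := Ordinal ltu) ia a7)
                   -(aeval_key_exp (e := Var 6) (v := v) ia a6).
      apply: wp_set; rewrite ?new; [by rewrite /=; lia| |].
        apply: leq_trans (count_size _ _) _; rewrite size_take size_enum_ord; case: ifP; lia.
      by split=> //; split=> //; do 2 apply: inv_temporary => //.
    move=> {ia a6}a _ [a6 ia a14].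
    rewrite take_oversize ?size_enum_ord // count_enum in a14.
    have {}a14 : amem a Sc 14 = order v by rewrite permE.
    have test : aeval (amem a) (Var 14 =e Var 5) = (v == v0).
      rewrite /= a14 (inv_i ia) /v0 -(inj_eq (@perm_inj _ order)) permKV.
      by rewrite -val_eqE.
    apply: wp_if; rewrite test.
      rewrite eqb0 negbK => /eqP e; apply: wp_emit; split=> //.
      apply: inv_temporary => //; apply: (inv_io ia) => //=.
      - exact: inv_passes ia.
      - exact: inv_coins ia.
      - by rewrite (inv_output ia) a6 -e /= ltnn ltnSn cats0 cats1.
    move/eqP; rewrite eqb0 => ne; apply: wp_skip; split=> //.
    apply: inv_temporary => //; rewrite ltnS leq_eqVlt.
    by have -> : (val v0 == j) = false by rewrite eq_sym; apply/negbTE.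
  + move=> {ia a5}a _ ia; split; first exact: inv_i ia.
    rewrite (take_enumS lti) map_rcons -cats1 -/out -/v0; apply: inv_index.
    by move: ia; rewrite (ltn_ord v0 : (v0 < n) = true) => ia; exact: ia.
by move=> {ia}a _ ia; rewrite (inv_passes ia) (inv_output ia) take_oversize ?size_enum_ord.
Qed.

End Print.

(** * The complete run *)

Section FullRun.

Variable r : seq bool.
Hypotheses (p0 : 0 < p) (pW : p <= W) (rsz : total_samples p b m p * b <= size r).
Hypotheses (bE : b = climb (fun x => 2 ^ x < n) n).
Hypotheses (mE : m = climb (fun x => x ^ p < n) n).
Hypotheses (mW : m <= W) (KW : forall i, i <= p -> pass_samples p b m i <= W).

Local Notation total := (total_samples p b m).
Local Notation xs := (samples b r (total p)).
Local Notation state i := (pass_state E es p b m xs i).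

Definition preparing (x y z : nat) (a : astate) : Prop :=
  [/\ amem a Sc 0 = n, amem a Sc 1 = x, amem a Sc 2 = y, amem a Sc 3 = z &
    [/\ amem a Sc 5 = 0, amem a Sc 8 = 0,
        (forall v, [/\ amem a Mk v = 0, amem a Cc v = 0 & amem a Dd v = 0]) &
        [/\ apasses a = 0, acoins a = r & aoutput a = [::]]]].

Lemma wp_prepare a : preparing 0 0 0 a ->
  wp (prepare p)
    (inv 0 (pass_samples p b m 0) false [::] (fun=> 0) (fun=> 0) 0 r [::]) a.
Proof.
move=> [a0 _ _ _ rest].
have n1 : n < B by have := ltn_expl b (ltnSn 1); lia.
apply: wp_seq; apply: wp_set => /=; [lia|lia|].
apply: wp_seq; apply: wp_set => /=; [lia|lia|].
apply: wp_seq; apply: wp_set => /=; [lia|lia|].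
have {a0 rest} : preparing 1 2 1 (aset (aset (aset a Sc 1 1) Sc 2 2) Sc 3 1).
  by split=> //=.
move: (aset _ _ _ _) => {}a pa.
pose c1 := climb (fun x => 2 ^ x < n); pose c2 := climb (fun x => x ^ p < n).
have c2m : c2 n = m by rewrite mE.
apply: wp_seq; apply: (wp_for (N := n) 
  (I := fun j => preparing (c1 j) (2 ^ c1 j) 1)) => //=; try lia.
- by move=> j a' _ _ [].
- move=> j {pa}a jn a6 [a0 a1 a2 a3 rest].
  have le : c1 j.+1 <= b by rewrite bE climb_mono.
  have le2 : 2 ^ c1 j.+1 <= 2 ^ b by rewrite leq_exp2l.
  have b2 := ltn_expl b (ltnSn 1).
  have s1 : c1 j + (2 ^ c1 j < n) = c1 j.+1 by [].
  have s2 : 2 ^ c1 j * (1 + (2 ^ c1 j < n)) = 2 ^ c1 j.+1.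
    by rewrite -s1 expnD; case: (_ < n); rewrite ?muln1.
  apply: wp_seq; apply: wp_set => /=; rewrite ?a0 ?a1 ?a2 ?s1; [lia|lia|].
  apply: wp_set => /=; rewrite ?a0 ?a2 ?s2; [lia|lia|].
  by split=> //; case: rest => *; split=> //=; split.
move=> {pa}a _ pa; apply: wp_seq.
apply: (wp_for (N := n) (I := fun j => preparing b (2 ^ b) (c2 j))) => //=; try lia.
- by rewrite bE; case: pa => ? ? ? ? [? ? ? ?]; split=> //=; split.
- by move=> j a' _ _ [].
- move=> j {pa}a jn a6 [a0 a1 a2 a3 rest].
  have le : c2 j.+1 <= m by rewrite mE climb_mono.
  apply: wp_set; rewrite ?[aeval _ (_ +e _)]/= ?aeval_power /= ?a0 ?a3; [lia| |].
    by rewrite -[_ + _]/(c2 j.+1); lia.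
  by split=> //; case: rest => *; split=> //=; split.
move=> {pa}a _ [a0 a1 a2 a3 [a5 a8 az [ps co out]]].
have KE : 32 * ((p + 5) * amem a Sc 1) * amem a Sc 3 = pass_samples p b m 0.
  by rewrite a1 a3 c2m /pass_samples expn1 -mulnA.
apply: wp_set => /=; rewrite ?KE; [lia|have := KW (leq0n p); lia|].
split=> //=.
- by rewrite a3 c2m.
- by move=> v; case: (az v).
- by move=> v; case: (az v).
- by move=> v; case: (az v).
Qed.

Lemma wp_program a : preparing 0 0 0 a ->
  wp (program p) (fun a' => apasses a' = p /\
    aoutput a' = [seq val ((key_order (@final_key_inj n E p (state p).1 (state p).2))^-1%g i)
                 | i <- enum 'I_n]) a.
Proof.
move=> pa; apply: wp_seq; apply: wp_mono (wp_prepare pa) _ => {pa}a ia.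
apply: wp_seq; apply: (wp_for (N := p) (I := fun i =>
  inv i (pass_samples p b m i) (state i).1 (take (total i) xs) (state i).2
    (fun v => i * indegree E v) i (drop (total i * b) r) [::])) => //=; try lia.
- apply: inv_index; rewrite /total_samples big_ord0 take0 mul0n drop0; exact: ia.
- move=> i {ia}a ip a5 ia.
  have tip : total i.+1 <= total p by apply: total_samples_le.
  have tS := total_samplesS p b m i.
  have Kcs : pass_samples p b m i * b <= size (drop (total i * b) r).
    rewrite size_drop leq_subRL -?mulnDl -?tS.
      by apply: leq_trans rsz; rewrite leq_mul2r tip orbT.
    by apply: leq_trans rsz; rewrite leq_mul2r; apply/orP; right; lia.
  apply: wp_seq; apply: wp_mono (wp_draw (KW (ltnW ip)) Kcs ia) _ => {ia a5}a [].
  rewrite (@samples_drop _ _ _ _ (total p)) -?tS // -takeD -tS => ia xa.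
  rewrite drop_drop -mulnDl addnC -tS in ia.
  have dB v : i * indegree E v + indegree E v <= B.
    rewrite -mulSnr; apply: leq_trans pnB; apply: leq_mul => //; exact: indegree_le.
  apply: wp_seq; apply: wp_mono (wp_collect dB ia) _ => {ia}a' [ia [st aX]].
  set K := pass_samples p b m i in tS Kcs xa ia *; set ys := take K (drop (total i) xs) in xa *.
  have ysx : {subset ys <= xs} by move=> x /mem_take/mem_drop.
  have sys : size ys = K by rewrite size_takel // size_drop size_mkseq; lia.
  have sub : {subset ys <= take (total i.+1) xs}.
    by move=> x; rewrite tS takeD mem_cat orbC => ->.
  have ysW x : x \in ys -> x <= W.
    by move=> /ysx/mapP[k _ ->]; apply: leq_trans bW; apply/ltnW/sample_lt.
  have sp := pass_state_spaced es p b m tE xs i.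
  apply: wp_seq; apply: wp_mono
    (wp_refine sp (KW (ltnW ip)) sys sub ysW _ ia st (fun j jK => etrans (aX j) (xa j jK))) _.
    by move/negbT; rewrite negb_or => /andP[_ /negbTE].
  move=> {ia st aX xa}a1 ia.
  have KS : K * m = pass_samples p b m i.+1 by rewrite /K /pass_samples -mulnA -expnSr.
  apply: wp_set => /=; rewrite ?(inv_K ia) ?(inv_m ia) ?KS; [lia|have := KW ip; lia|].
  split; first by rewrite (inv_i ia).
  apply: inv_index; move: ia; rewrite /ys /K; case: (state i) => f c /= ia.
  apply: (inv_ext (_ : inv _ _ _ _ _ (fun v => i * indegree E v + indegree E v) _ _ _ _)) => //.
    by case: ia => *; split.
  by move=> v; rewrite /= mulSnr.
move=> {ia}a _ ia; apply: wp_mono (wp_print _ ia) _ => [//|//].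
Qed.

End FullRun.
End Correctness.

(** * Resource bounds *)

Lemma leq_expr k m n : m <= n -> m ^ k <= n ^ k.
Proof. by case: k => // k; rewrite leq_exp2r. Qed.

Section Polynomial.

(* Unlike [c * n ^ k + c], this form is closed under products. *)
Definition poly_le (f : nat -> nat) : Prop :=
  exists c k, forall n, f n <= c * n.+1 ^ k.

Lemma poly_le_bounded f : poly_le f -> poly_bounded f.
Proof.
move=> [c [k H]]; exists (c * 2 ^ k), k => -[|n].
  by have := H 0; have := expn_gt0 2 k; rewrite exp1n; nia.
apply: leq_trans (H _) (leq_trans _ (leq_addr _ _)).
by rewrite -mulnA -expnMn leq_mul // leq_expr //; lia.
Qed.

Lemma poly_le_trans f g : (forall n, f n <= g n) -> poly_le g -> poly_le f.
Proof. by move=> fg [c [k H]]; exists c, k => n; apply: leq_trans (H n). Qed.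

Lemma poly_le_const c : poly_le (fun=> c).
Proof. by exists c, 0 => n; rewrite muln1. Qed.

Lemma poly_le_succ : poly_le S.
Proof. by exists 1, 1 => n; rewrite mul1n expn1. Qed.

Lemma poly_le_add f g : poly_le f -> poly_le g -> poly_le (fun n => f n + g n).
Proof.
move=> [c [k H]] [c' [k' H']]; exists (c + c'), (k + k') => n.
rewrite mulnDl leq_add //.
  by apply: leq_trans (H n) _; rewrite leq_mul // leq_pexp2l // leq_addr.
by apply: leq_trans (H' n) _; rewrite leq_mul // leq_pexp2l // leq_addl.
Qed.

Lemma poly_le_mul f g : poly_le f -> poly_le g -> poly_le (fun n => f n * g n).
Proof.
move=> [c [k H]] [c' [k' H']]; exists (c * c'), (k + k') => n.
by rewrite expnD mulnACA leq_mul.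
Qed.

Lemma poly_le_exp f k : poly_le f -> poly_le (fun n => f n ^ k).
Proof.
move=> pf; elim: k => [|k IH]; first exact: poly_le_const.
by apply: poly_le_trans (poly_le_mul pf IH) => n; rewrite expnS.
Qed.

(** The program is fixed, so the degree depends only on its nesting of loops. *)
Lemma poly_le_max_time Z c : poly_le Z -> poly_le (fun n => max_time (Z n) c).
Proof.
move=> pZ; elim: c => [e1 e2|e||e|e|c1 IH1 c2 IH2|e c1 IH1 c2 IH2|e c IH] /=;
  try exact: poly_le_const.
- apply: poly_le_trans (poly_le_add (poly_le_const 1) (poly_le_add IH1 IH2)) => n; lia.
- apply: poly_le_trans (poly_le_add (poly_le_const 1) (poly_le_add IH1 IH2)) => n; lia.
- apply: poly_le_trans (poly_le_add (poly_le_const 1)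
    (poly_le_mul pZ (poly_le_add (poly_le_const 1) IH))) => n; lia.
Qed.

End Polynomial.

Definition bits (n : nat) : nat := climb (fun x => 2 ^ x < n) n.

Lemma bits_gt0 n : 0 < bits n. Proof. exact: climb_gt0. Qed.

Lemma leq_bits n : n <= 2 ^ bits n.
Proof.
rewrite leqNgt; apply/negbT/(climb_stop (P := fun x => 2 ^ x < n)) => x.
by have := ltn_expl x (ltnSn 1); lia.
Qed.

Lemma bits_pred n : bits n = 1 \/ 2 ^ (bits n).-1 < n.
Proof. exact: climb_pred. Qed.

Lemma pow_bits_le n : 2 ^ bits n <= 2 * n.+1.
Proof.
have := bits_gt0 n; case: (bits_pred n) => [->|]; first by lia.
by case: (bits n) => //= k; rewrite expnS; lia.
Qed.

Lemma bits_le n : bits n <= 2 * n.+1.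
Proof. by apply: leq_trans (pow_bits_le n); apply/ltnW/ltn_expl. Qed.

(** * Bounds on indices, values, steps and space *)

Section Bounds.

Variable p : nat.
Hypothesis p0 : 0 < p.

Definition root (n : nat) : nat := climb (fun x => x ^ p < n) n.
(** Room for stored edges and samples (the capacity), marks (below [2 ^ b]) and scalars (up to
    15). *)
Definition max_index (n : nat) : nat := capacity p (bits n) (root n) + 2 ^ bits n + 16.
Definition max_value (n : nat) : nat := (p + 2) * max_index n ^ 2.
(** There are as many coins as steps; the second summand guarantees enough coins for all samples. *)
Definition max_steps (n : nat) : nat :=
  max_time (max_value n) (program p)
    + total_samples p (bits n) (root n) p * bits n.
Definition max_space (n : nat) : nat :=
  8 * (max_index n).+1 * (trunc_log 2 (max_value n)).+1.

Lemma root_gt0 n : 0 < root n. Proof. exact: climb_gt0. Qed.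

Lemma leq_root n : n <= root n ^ p.
Proof.
rewrite leqNgt; apply/negbT/(climb_stop (P := fun x => x ^ p < n)) => x.
move=> xn; apply: leq_trans (ltnW xn); case: x {xn} => // x.
by rewrite -[leqLHS]expn1 leq_pexp2l.
Qed.

Lemma root_pred n : root n = 1 \/ (root n).-1 ^ p < n.
Proof. exact: (climb_pred (fun x => x ^ p < n)). Qed.

Lemma root_le n : root n <= n.+1.
Proof.
case: (root_pred n) => [-> //|lt]; suff : (root n).-1 <= n by lia.
apply: leq_trans (ltnW lt); case: ((root n).-1) => // x.
by rewrite -[leqLHS]expn1 leq_pexp2l.
Qed.

(** Follows from [2 ^ (bits n).-1 < n <= root n ^ p]; for [n = 1] both sides equal 2. *)
Lemma pow_bits_lt n : 1 < n -> 2 ^ bits n < 2 * root n ^ p.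
Proof.
move=> n1; have := leq_root n; have := bits_gt0 n; case: (bits_pred n) => [->|]; first by lia.
by case: (bits n) => //= k; rewrite expnS; lia.
Qed.

Lemma pass_samples_capacity n i : i <= p ->
  pass_samples p (bits n) (root n) i <= capacity p (bits n) (root n).
Proof.
move=> ip; rewrite /pass_samples /capacity leq_mul //; first by rewrite leq_mul2r; lia.
by rewrite leq_pexp2l ?root_gt0.
Qed.

Lemma capacity_ge n : root n <= capacity p (bits n) (root n) /\ p <= capacity p (bits n) (root n).
Proof.
have m0 := root_gt0 n; have b0 := bits_gt0 n; rewrite /capacity.
have Y : root n <= root n ^ p.+1 by rewrite -[leqLHS]expn1 leq_pexp2l.
have q : p <= 64 * p * ((p + 5) * bits n) by nia.
split; first by apply: leq_trans Y _; rewrite leq_pmull //; lia.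
by apply: leq_trans q _; rewrite leq_pmulr //; lia.
Qed.

Lemma poly_le_index : poly_le max_index.
Proof.
have pb : poly_le bits.
  exact: poly_le_trans bits_le (poly_le_mul (poly_le_const 2) poly_le_succ).
have pr : poly_le root by apply: poly_le_trans root_le poly_le_succ.
apply/poly_le_add/poly_le_const; apply: poly_le_add.
  apply: poly_le_mul (poly_le_exp p.+1 pr).
  exact: poly_le_mul (poly_le_const _) (poly_le_mul (poly_le_const _) pb).
exact: poly_le_trans pow_bits_le (poly_le_mul (poly_le_const 2) poly_le_succ).
Qed.

Lemma poly_le_value : poly_le max_value.
Proof. exact: poly_le_mul (poly_le_const _) (poly_le_exp 2 poly_le_index). Qed.

Lemma poly_bounded_steps : poly_bounded max_steps.
Proof.
apply/poly_le_bounded/poly_le_add; first exact: poly_le_max_time poly_le_value.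
apply: poly_le_mul (poly_le_trans bits_le (poly_le_mul (poly_le_const 2) poly_le_succ)).
apply: poly_le_trans (poly_le_mul (poly_le_const p) poly_le_index) => n.
rewrite /total_samples -[p in p * _]card_ord -sum_nat_const leq_sum // => i _.
apply: leq_trans (pass_samples_capacity n (ltnW (ltn_ord i))) _.
by rewrite /max_index -addnA leq_addr.
Qed.

End Bounds.

(** * The space bound up to logarithmic factors *)

Section Space.

Variable R : realType.
Local Open Scope ring_scope.

Lemma log_le (t : nat -> nat) (f : nat -> nat) :
  poly_le f -> (forall n, (2 ^ t n <= f n)%N) ->
  exists2 C : R, 0 <= C & forall n, (2 <= n)%N -> (t n)%:R <= C * ln n%:R.
Proof.
move=> [c [k H]] tf.
have l2 : 0 < ln (2 : R) by rewrite ln_gt0 // ltr1n.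
pose a : R := ln (c.+1 * 2 ^ k)%:R.
have a0 : 0 <= a by rewrite ln_ge0 // ler1n muln_gt0 expn_gt0.
exists (a / ln 2 / ln 2 + k%:R / ln 2) => [|n n2].
  by rewrite addr_ge0 ?divr_ge0 // ltW.
have n0 : 0 < (n%:R : R) by rewrite ltr0n; lia.
have l2n : ln 2 <= ln (n%:R : R) by rewrite ler_ln ?posrE // ler_nat.
have le : (2 ^ t n <= c.+1 * 2 ^ k * n ^ k)%N.
  apply: leq_trans (tf n) (leq_trans (H n) _).
  by rewrite -mulnA -expnMn leq_mul // leq_expr //; lia.
have lnle : (t n)%:R * ln 2 <= a + k%:R * ln (n%:R : R).
  have leR : (2 : R) ^+ t n <= (c.+1 * 2 ^ k)%:R * n%:R ^+ k.
    by rewrite -!natrX -natrM ler_nat.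
  have cp : 0 < ((c.+1 * 2 ^ k)%:R : R) by rewrite ltr0n muln_gt0 expn_gt0.
  move: leR; rewrite -ler_ln ?posrE ?mulr_gt0 ?exprn_gt0 // lnM ?posrE ?exprn_gt0 //.
  by rewrite !lnXn // -/a -(mulr_natl (ln 2)) -(mulr_natl (ln _) k).
(* Additive constants are absorbed because [ln 2 <= ln n]. *)
have al : a <= a / ln 2 * ln n%:R.
  by rewrite -mulrA ler_peMr // mulrC ler_pdivlMr // mul1r.
have : (t n)%:R <= (a + k%:R * ln (n%:R : R)) / ln 2 by rewrite ler_pdivlMr.
move/le_trans; apply; rewrite ler_pdivrMr //.
rewrite (_ : _ * ln 2 = a / ln 2 * ln n%:R + k%:R * ln n%:R); first by rewrite lerD2r.
by field; rewrite lt0r_neq0.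
Qed.

Lemma root_real_le (p n : nat) : (0 < p)%N -> (0 < n)%N ->
  (root p n)%:R <= 2 * n%:R `^ p%:R^-1 :> R.
Proof.
move=> p0 n0; set x := n%:R `^ _.
have x1 : 1 <= x by rewrite -[leLHS](powRr0 n%:R) ler_powR ?ler1n.
have xp : x ^+ p = n%:R.
  rewrite -powR_mulrn ?powR_ge0 // -powRrM mulVf ?powRr1 //.
  by rewrite pnatr_eq0 -lt0n.
case: (root_pred p n) => [->|lt]; first by lra.
have : (root p n).-1%:R < x.
  by rewrite -(@ltr_pXn2r _ p) ?nnegrE ?powR_ge0 // xp -natrX ltr_nat.
by rewrite -[in leLHS](prednK (root_gt0 p n)) -natr1; lra.
Qed.

Lemma soft_O_space (p : nat) : (0 < p)%N ->
  soft_O (fun n => (max_space p n)%:R : R) (fun n => n%:R `^ (1 + p%:R^-1)).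
Proof.
move=> p0.
have [C C0 bC] : exists2 C : R, 0 <= C & forall n, (2 <= n)%N -> (bits n)%:R <= C * ln n%:R.
  exact: log_le (poly_le_mul (poly_le_const 2) poly_le_succ) pow_bits_le.
have [D D0 tD] : exists2 D : R, 0 <= D & forall n, (2 <= n)%N ->
    (trunc_log 2 (max_value p n))%:R <= D * ln n%:R.
  apply: (@log_le _ (max_value p)); first exact: poly_le_value.
  move=> n; apply: trunc_logP => //; rewrite /max_value /max_index.
  by rewrite muln_gt0 expn_gt0 !addn_gt0 !orbT.
have l2 : 0 < ln (2 : R) by rewrite ln_gt0 // ltr1n.
pose c0 : R := (64 * p * (p + 5))%:R * 2 ^+ p.+1.
have c00 : 0 <= c0 by rewrite mulr_ge0 ?exprn_ge0.
(* One logarithm comes from [bits n] in the capacity, the other from the length of a memory cell.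
   The 21 covers [2 ^ bits n + 17 <= 2 * n + 19], and [(ln 2)^-1] the successor of the logarithm. *)
exists (8 * (c0 * C + 21 / ln 2) * (D + (ln 2)^-1)), 2, 2 => n n2.
set X := n%:R `^ _; set l := ln n%:R.
have n0 : (0 < n)%N by lia.
have ll : 1 <= l / ln 2 by rewrite ler_pdivlMr // mul1r ler_ln ?posrE ?ltr0n // ler_nat.
have XE : X = n%:R * n%:R `^ p%:R^-1.
  by rewrite /X powRD ?powRr1 // pnatr_eq0 -lt0n n0 implybT.
have nX : n%:R <= X by apply: le1r_powR; rewrite ?ler1n // lerDl invr_ge0.
have X0 : 0 <= X by rewrite powR_ge0.
have mX : (root p n ^ p.+1)%:R <= 2 ^+ p.+1 * X :> R.
  rewrite natrX (le_trans (_ : _ <= (2 * n%:R `^ p%:R^-1) ^+ p.+1)) //.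
    by rewrite lerXn2r ?nnegrE ?mulr_ge0 ?powR_ge0 // root_real_le.
  rewrite exprMn XE ler_wpM2l ?exprn_ge0 // exprSr -powR_mulrn ?powR_ge0 // -powRrM.
  by rewrite mulVf ?powRr1 // pnatr_eq0 -lt0n.
have bl := bC n n2; have tl := tD n n2.
have capX : (capacity p (bits n) (root p n))%:R <= c0 * C * (X * l).
  rewrite /capacity (_ : _ * _ = 64 * p * (p + 5) * (bits n * root p n ^ p.+1))%N; last by lia.
  rewrite natrM /c0; move: (64 * p * (p + 5))%N => q.
  apply: le_trans (_ : q%:R * (C * l * (2 ^+ p.+1 * X)) <= _).
    by rewrite ler_wpM2l // natrM ler_pM.
  by rewrite le_eqVlt; apply/orP; left; apply/eqP; ring.
have ixX : ((max_index p n).+1)%:R <= (c0 * C + 21 / ln 2) * (X * l).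
  rewrite /max_index -addSn -!addnS -addnA natrD mulrDl lerD //.
  apply: le_trans (_ : 21 * X <= _); last first.
    by rewrite (_ : 21 / ln 2 * _ = 21 * X * (l / ln 2)) ?ler_peMr ?mulr_ge0 //; ring.
  apply: le_trans (_ : 21 * n%:R <= _); last by rewrite ler_wpM2l.
  by rewrite -natrM ler_nat; have := pow_bits_le n; lia.
rewrite /max_space !natrM.
have tlX : ((trunc_log 2 (max_value p n)).+1)%:R <= (D + (ln 2)^-1) * l.
  by rewrite -natr1 mulrDl lerD // mulrC.
apply: le_trans (ler_pM _ _ (ler_wpM2l _ ixX) tlX) _ => //.
by rewrite le_eqVlt; apply/orP; left; apply/eqP; ring.
Qed.

End Space.

Local Open Scope ring_scope.

(** * The returned ordering and its expected cost *)

Section Run.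

Variables (p n : nat) (E : rel 'I_n) (es : seq ('I_n * 'I_n)).
Hypotheses (p0 : (0 < p)%N) (tE : tournament E) (sE : edge_stream E es).

Definition final_order (r : seq bool) : 'S_n :=
  let xs := samples (bits n) r (total_samples p (bits n) (root p n) p) in
  let fc := pass_state E es p (bits n) (root p n) xs p in
  key_order (@final_key_inj n E p fc.1 fc.2).

Lemma returns_final_order (r : seq bool) : size r = max_steps p n ->
  returns_within (program p) es r (max_steps p n) p (max_space p n) (final_order r).
Proof.
move=> sr; set b := bits n; set m := root p n; set W := max_index p n.
have capW : (capacity p b m + 2 ^ b + 16 <= W)%N by [].
have [mc pc] := capacity_ge p0 n; have nb := leq_bits n.
rewrite -/b -/m in mc pc nb.
have BE : max_value p n = ((p + 2) * (W * W))%N by rewrite /max_value mulnn.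
have WB : (W.*2 <= max_value p n)%N by rewrite BE; nia.
have nnB : (n * n <= max_value p n)%N.
  rewrite BE; apply: leq_trans (_ : W * W <= _)%N; last by rewrite leq_pmull //; lia.
  by apply: leq_mul; lia.
have pnB : (p * n <= max_value p n)%N by rewrite BE leq_mul //; nia.
have rsz : (total_samples p b m p * b <= size r)%N by rewrite sr leq_addl.
have KW i : (i <= p)%N -> (pass_samples p b m i <= W)%N.
  by move=> ip; have := pass_samples_capacity p0 n ip; rewrite -/b -/m; lia.
pose s0 := State [:: n] [::] 0 r [::].
have pre : preparing n r 0 0 0 (abs s0).
  have far r' i : amem (abs s0) r' i = if (8 * i + arr_code r' == 0)%N then n else 0%N.
    by rewrite /=; case: (_ + _)%N => [|[|k]].
  split; rewrite ?far //; split; rewrite ?far //.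
  by move=> v; split; rewrite far; case: v => // v; rewrite mulnS.
have fs : fits W (max_value p n) s0 by split=> /=; rewrite ?andbT; lia.
have prog := wp_program (p := p) (b := b) (m := m) (W := W) (B := max_value p n) tE sE.
have [||||||s' [e [ps out] f]] :=
  wp_run (prog _ _ _ _ WB nnB pnB r p0 _ rsz erefl erefl _ KW _ pre) fs
    (leq_addr _ _ : _ <= max_steps p n)%N.
all: try by lia.
rewrite /returns_within /run e; split=> //=.
- by rewrite -[passes s']/(apasses (abs s')) ps.
- by move=> t; apply: fits_space; apply: f.
Qed.

Variable R : realType.

Lemma expect_final_order :
  expect_coins (fun r : (max_steps p n).-tuple bool => #|back_edges E (final_order r)|%:R : R)
    <= 3 * (beta E)%:R.
Proof.
rewrite (expect_coinsE _ (fun r => #|back_edges E (final_order r)|%:R)) /beta.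
set s := [arg min_(_ < _) _].
set b := bits n; set m := root p n.
(* With [beta E = 0] no gain could pay for failures, so the ordering must be exact for all coins. *)
have [s0|] := posnP #|back_edges E s|.
  rewrite s0 mulr0 le_eqVlt; apply/orP; left; apply/eqP.
  have c2 : (0 < #|{: bool}|)%N by rewrite card_bool.
  rewrite -[RHS](mean_cst (max_steps p n) 0 c2); apply: mean_ext => r _.
  rewrite /final_order.
  have := back_edges_transitive es b m tE p0 s0 (samples b r (total_samples p b m p)) p.
  by rewrite /b /m; case: pass_state => f c /= ->.
(* A back edge has two distinct ends; [1 < n] is what [pow_bits_lt] requires. *)
move=> be0; have n1 : (1 < n)%N.
  have /card_gt0P[[u v]] := be0; rewrite inE /= => /andP[uv _].
  have ne : val u != val v.
    by apply: contraTneq uv => /val_inj ->; rewrite (edge_irr tE).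
  by have := ltn_ord u; have := ltn_ord v; rewrite /= in ne; lia.
have b0 := bits_gt0 n; have m0 := root_gt0 p n.
apply: le_trans (mean_cost_bound R tE (leq_bits n) b0 m0 p0 be0).
rewrite -(mean_samples (m := max_steps p n)
  (fun l => (cost_bound E p b m l)%:R)) ?leq_addl //.
apply: mean_le => r _; rewrite ler_nat /final_order.
set xs := samples _ _ _.
have := back_edges_balanced tE sE p0 m0 (leq_root p0 n) (pow_bits_lt p0 n1) (xs := xs).
by rewrite size_mkseq => /(_ erefl); case: pass_state.
Qed.

End Run.

Theorem theorem3p5 (R : realType) (p : nat) (hp : (1 <= p)%N) :
  exists (A : cmd) (T S : nat -> nat),
    [/\ poly_bounded T,
        soft_O (fun n => (S n)%:R : R) (fun n => n%:R `^ (1 + p%:R^-1))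
      & forall (n : nat) (E : rel 'I_n) (es : seq ('I_n * 'I_n)),
          tournament E -> edge_stream E es ->
          exists sigma : (T n).-tuple bool -> 'S_n,
            (forall r : (T n).-tuple bool,
                returns_within A es r (T n) p (S n) (sigma r)) /\
            expect_coins (fun r => #|back_edges E (sigma r)|%:R : R)
              <= 3 * (beta E)%:R].
Proof.
exists (program p), (max_steps p), (max_space p); split.
- exact: poly_bounded_steps hp.
- exact: soft_O_space.
move=> n E es tE sE; exists (fun r => final_order p E es r); split=> [r|].
  by apply: returns_final_order; rewrite ?size_tuple.
exact: expect_final_order.
Qed.
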